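(* Let $H$ be a real separable Hilbert space and let $\varphi(t,x,\omega)$, $t\in\mathbb R$, be a random dynamical system on $H$ with linearization $U(t,\omega)$ at $0$, generated by the random differential equation $$\frac{du}{dt}=A(\theta_t\omega)u+B(\theta_t\omega)u,\qquad u(0,x,\omega)=x, \tag{$*$}$$ with $A$, $B$ as in the context, where $B(\theta_t\omega)(0)=0$ and $|B(\theta_t\omega)u_1-B(\theta_t\omega)u_2|\le\operatorname{Lip}B\,|u_1-u_2|$ for all $u_1,u_2\in H$. Suppose that $U(t,\omega)$ satisfies the exponential trichotomy with constants $\alpha,\beta,\gamma$ and tempered random variables $K^s,K^c,K^u$, and put $K(\omega)=\max\{K^s(\omega),K^c(\omega),K^u(\omega)\}$. If $\gamma<\eta<\min\{\beta,\alpha\}$ is such that $$K(\omega)\operatorname{Lip}B\left(\frac1{\eta-\gamma}+\frac1{\beta-\eta}+\frac1{\alpha-\eta}\right)<1,$$ then there exists a center manifold for the random differential equation $( * )$, which is written as the graph $$M^c(\omega)=\{v+h^c(v,\omega)\mid v\in H^c\},$$ where $M^c(\omega)=\{u_0\in H\mid u(\cdot,u_0,\omega)\in C_\eta\}$, $u(t,u_0,\omega)$ is the solution of $( * )$ with $u(0)=u_0$, and $h^c(\cdot,\omega):H^c\to H^u\oplus H^s$ is a Lipschitz continuous mapping from the center subspace which satisfies $h^c(0,\omega)=0$.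
   Context: $(\Omega,\mathcal F,\mathbb P)$ is a complete probability space with a group $\theta_t$, $t\in\mathbb R$, of $\mathbb P$-preserving ergodic transformations. $|\cdot|$ is the norm of $H$. A random dynamical system on $H$ with time set $\mathbb T=\mathbb R$ is a jointly measurable mapping $\varphi:\mathbb T\times H\times\Omega\to H$ with $\varphi(t_1+t_2,\cdot,\omega)=\varphi(t_2,\cdot,\theta_{t_1}\omega)\circ\varphi(t_1,\cdot,\omega)$ and $\varphi(0,x,\omega)=x$. It is linear if each map on $H$ is linear. Setting. $\varphi(t,0,\omega)=0$, $\varphi$ is Fréchet differentiable in $x$, and $U(t,\omega)=D\varphi(t,0,\omega)$ is its linearization at the fixed point $0$, a linear random dynamical system. $\varphi$ and $U$ are differentiable in $t$ at $t=0$, and $f(\omega,x)=\frac{d}{dt}\varphi(t,x,\omega)|_{t=0}$, $A(\omega)x=\frac{d}{dt}U(t,\omega)x|_{t=0}$, $B(\omega)x=f(\omega,x)-A(\omega)x$. Thus $\varphi$ is the solution of $( * )$ and $U$ is the solution of $dv/dt=A(\theta_t\omega)v$, $v(0)=x$. Function space. For $\eta>0$, $C_\eta=\{\phi\in C(\mathbb R,H)\mid\sup_{t\in\mathbb R}e^{-\eta|t|}|\phi(t)|<\infty\}$, with norm $|\phi|_{C_\eta}=\sup_{t\in\mathbb R}e^{-\eta|t|}|\phi(t)|$. Tempered: a random variable $X:\Omega\to(0,\infty)$ is tempered from above if $\limsup_{t\to\pm\infty}\log^+X(\theta_t\omega)/|t|=0$ on a $\theta$-invariant set of full measure, tempered from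 below if $X^{-1}$ is tempered from above, and tempered if both. Exponential trichotomy. A linear random dynamical system $U(t,\omega)$, $t\in\mathbb T$, satisfies the exponential trichotomy if there is a $\theta_t$-invariant set $\tilde\Omega\subset\Omega$ of full measure such that for each $\omega\in\tilde\Omega$, $H=E^s(\omega)\oplus E^c(\omega)\oplus E^u(\omega)$ with closed subspaces such that: (1) $U(t,\omega)E^k(\omega)\subset E^k(\theta_t\omega)$ for $k=s,c,u$; (2) there are constants $\alpha,\beta>\gamma>0$ and tempered random variables $K^s,K^c,K^u:\tilde\Omega\to(0,\infty)$ such that, with $U^k(t,\omega)$ the part of $U(t,\omega)$ on $E^k(\omega)$, $\|U^s(t,\omega)\|\le K^s(\omega)e^{-\alpha t}$ for $t\ge0$, $\|U^c(t,\omega)\|\le K^c(\omega)e^{\gamma|t|}$ for all $t\in\mathbb T$, $\|U^u(t,\omega)\|\le K^u(\omega)e^{\beta t}$ for $t\le0$. The spaces $H^s,H^c,H^u$ denote $E^s(\omega),E^c(\omega),E^u(\omega)$, with associated projections $P^s,P^c,P^u$. The hypotheses and conclusions on $\omega$ are understood for $\omega\in\tilde\Omega$. Center manifold. A random set $M(\omega)$ (i.e. $\omega\mapsto\inf_{y\in M(\omega)}|x-y|$ is measurable for every $x\in H$) is (forward) invariant for $\varphi$ if $\varphi(t,M(\omega),\omega)\subset M(\theta_t\omega)$ for $t\ge0$. An invariant random set is a (Lipschitz) center manifold if it is a graph $M(\omega)=\{v+h^c(v,\omega)\mid v\in H^c\}$ of a Lipschitz mapping $h^c(\cdot,\omega):H^c\to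 H^u\oplus H^s$ with $h^c(0,\omega)=0$, the tangency condition $Dh^c(0,\omega)=0$, and $h^c(v,\cdot)$ measurable for every $v\in H^c$ (i.e. $\omega\mapsto h^c(P^cx,\omega)$ measurable for every $x\in H$).
   Formalization: The trichotomy bounds on U^k are imposed on U(t,ω)P^k(ω) as an operator on all of H, so K(ω) also bounds the norms of the projections; with bounds only on the restrictions to E^k(ω) the claim fails for oblique splittings. *)

(* Defs.v *)
From HB Require Import structures.
From mathcomp Require Export all_boot all_order all_algebra.
From mathcomp Require Export all_classical all_reals all_analysis.
From mathcomp Require Export measurable_realfun.

Set Implicit Arguments.
Unset Strict Implicit.
Unset Printing Implicit Defensive.

Export Order.TTheory GRing.Theory Num.Theory.
Export numFieldNormedType.Exports.

Local Open Scope classical_set_scope.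
Local Open Scope ring_scope.

(* The norm of H is the one induced by the symmetric positive definite form;
   completeness is part of the type of H. *)
Definition hilbert_product (R : realType) (H : completeNormedModType R)
    (dot : {dot H for (@idfun R)}) : Prop :=
  forall x : H, `|x| ^+ 2 = dot x x.

Definition separable (T : topologicalType) : Prop :=
  exists D : set T, countable D /\ dense D.

Definition borel (T : ptopologicalType) := g_sigma_algebraType (@open T).

Section Flow.
Context {R : realType} {d : measure_display} {Omega : measurableType d}.
Implicit Types (P : probability Omega R) (theta : R -> Omega -> Omega).

Definition theta_invariant theta (W : set Omega) : Prop :=
  forall t, theta t @^-1` W = W.

(* Ergodicity is that of the group as a whole (theta 0 is the identity, which
   is never ergodic on its own unless the probability space is trivial). *)
Record ergodic_flow P theta : Prop := ErgodicFlow {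
  flow0 : forall w, theta 0 w = w ;
  flowD : forall s t w, theta (s + t) w = theta s (theta t w) ;
  flow_measurable : forall t, measurable_fun [set: Omega] (theta t) ;
  flow_preserving : forall t (E : set Omega), measurable E ->
    P (theta t @^-1` E) = P E ;
  flow_ergodic : forall E : set Omega, measurable E ->
    theta_invariant theta E -> P E = 0%:E \/ P E = 1%:E
}.

Definition log_plus (x : R) : R := Num.max 0 (ln x).

(* Random variables defined on the invariant set W of full measure; the
   limits superior are taken at every point of W. *)
Definition tempered_above theta (W : set Omega) (X : Omega -> R) : Prop :=
  forall w, W w ->
    limf_esup (fun t : R => (log_plus (X (theta t w)) / `|t|)%:E)
      (pinfty_nbhs R) = 0%:E /\
    limf_esup (fun t : R => (log_plus (X (theta t w)) / `|t|)%:E)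
      (ninfty_nbhs R) = 0%:E.

Record tempered theta (W : set Omega) (X : Omega -> R) : Prop := Tempered {
  tempered_measurable : measurable_fun W X ;
  tempered_pos : forall w, W w -> 0 < X w ;
  tempered_from_above : tempered_above theta W X ;
  tempered_from_below : tempered_above theta W (fun w => (X w)^-1)
}.

End Flow.

Section RandomDynamicalSystems.
Context {R : realType} {H : completeNormedModType R}.
Context {d : measure_display} {Omega : measurableType d}.
Implicit Types (theta : R -> Omega -> Omega) (phi U : R -> H -> Omega -> H).

Record rds theta phi : Prop := Rds {
  rds_measurable : measurable_fun [set: R * borel H * Omega]
    (fun p : R * borel H * Omega => phi p.1.1 p.1.2 p.2 : borel H) ;
  rds0 : forall x w, phi 0 x w = x ;
  rdsD : forall t1 t2 x w,
    phi (t1 + t2) x w = phi t2 (phi t1 x w) (theta t1 w)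
}.

Definition linear_rds theta U : Prop :=
  rds theta U /\ forall t w, linear (fun x => U t x w).

(* Fréchet derivative of phi t at the fixed point 0, applied to x. *)
Definition linearization phi : R -> H -> Omega -> H :=
  fun t x w => 'd (fun y : H => phi t y w) (0 : H) x.

Definition generator phi : Omega -> H -> H :=
  fun w x => derive1 (fun t : R => phi t x w) 0.

Definition linear_part phi : Omega -> H -> H := generator (linearization phi).

Definition nonlinear_part phi : Omega -> H -> H :=
  fun w x => generator phi w x - linear_part phi w x.

Record smooth_at_fixed_point phi : Prop := SmoothAtFixedPoint {
  fixed_point0 : forall t w, phi t 0 w = 0 ;
  space_diff : forall t x w, differentiable (fun y : H => phi t y w) x ;
  time_derivable : forall x w, derivable (fun t : R => phi t x w) 0 1 ;
  time_derivable_lin : forall x w,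
    derivable (fun t : R => linearization phi t x w) 0 1
}.

Definition solves theta (A B : Omega -> H -> H) (w : Omega) (x : H)
    (u : R -> H) : Prop :=
  u 0 = x /\
  forall t : R, is_derive t 1 u (A (theta t w) (u t) + B (theta t w) (u t)).

Definition generated_by theta (A B : Omega -> H -> H) phi : Prop :=
  forall x w, solves theta A B w x (fun t => phi t x w).

Definition C_eta (eta : R) : set (R -> H) :=
  [set u | continuous u /\
    (ereal_sup [set (expR (- eta * `|t|) * `|u t|)%:E | t in [set: R]]
      < +oo)%E].

Record closed_subspace (E : set H) : Prop := ClosedSubspace {
  subspace0 : E 0 ;
  subspaceP : forall (a : R) x y, E x -> E y -> E (a *: x + y) ;
  subspace_closed : closed E
}.

Definition set_sum (E F : set H) : set H := [set x + y | x in E & y in F].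

Definition direct_sum3 (E F G : set H) : Prop :=
  forall x : H, exists! p : H * H * H,
    [/\ E p.1.1, F p.1.2, G p.2 & x = p.1.1 + p.1.2 + p.2].

(* Projection onto E along F, meaningful when H is the direct sum of both. *)
Definition proj_along (E F : set H) (x : H) : H :=
  xget 0 [set y | E y /\ F (x - y)].

Definition op_norm (T : H -> H) : \bar R :=
  ereal_sup [set `|T x|%:E | x in [set x : H | `|x| <= 1]].

Section Splitting.
Variables Es Ec Eu : Omega -> set H.

Definition Ps (w : Omega) := proj_along (Es w) (set_sum (Ec w) (Eu w)).
Definition Pc (w : Omega) := proj_along (Ec w) (set_sum (Es w) (Eu w)).
Definition Pu (w : Omega) := proj_along (Eu w) (set_sum (Es w) (Ec w)).

(* The part of U(t, w) on E^k(w) is U(t, w) P^k(w), an operator on H, so that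
   the bounds at t = 0 also control the norms of the projections.  These are
   the operators that occur, applied to arbitrary vectors B(theta_s w)(u(s)),
   in the Lyapunov-Perron equation.  Bounding only the restrictions to E^k(w)
   would leave the angles between the subspaces uncontrolled. *)
Record exponential_trichotomy (P : probability Omega R) theta U
    (W : set Omega) (alpha beta gamma : R) (Ks Kc Ku : Omega -> R) : Prop :=
  ExponentialTrichotomy {
  tri_measurable : measurable W ;
  tri_full : P W = 1%:E ;
  tri_invariant : theta_invariant theta W ;
  tri_closed : forall w, W w ->
    [/\ closed_subspace (Es w), closed_subspace (Ec w)
      & closed_subspace (Eu w)] ;
  tri_sum : forall w, W w -> direct_sum3 (Es w) (Ec w) (Eu w) ;
  tri_stable : forall t w, W w ->
    [/\ (fun x => U t x w) @` Es w `<=` Es (theta t w),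
        (fun x => U t x w) @` Ec w `<=` Ec (theta t w)
      & (fun x => U t x w) @` Eu w `<=` Eu (theta t w)] ;
  tri_const : [/\ 0 < gamma, gamma < alpha & gamma < beta] ;
  tri_tempered : [/\ tempered theta W Ks, tempered theta W Kc
                   & tempered theta W Ku] ;
  tri_s : forall w t, W w -> 0 <= t ->
    (op_norm (fun x => U t (Ps w x) w) <= (Ks w * expR (- alpha * t))%:E)%E ;
  tri_c : forall w t, W w ->
    (op_norm (fun x => U t (Pc w x) w) <= (Kc w * expR (gamma * `|t|))%:E)%E ;
  tri_u : forall w t, W w -> t <= 0 ->
    (op_norm (fun x => U t (Pu w x) w) <= (Ku w * expR (beta * t))%:E)%E
}.

Definition random_set (W : set Omega) (M : Omega -> set H) : Prop :=
  forall x : H, measurable_fun W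
    (fun w => ereal_inf [set `|x - y|%:E | y in M w]).

Definition forward_invariant theta phi (W : set Omega) (M : Omega -> set H) :=
  forall t w, W w -> 0 <= t ->
    (fun x => phi t x w) @` M w `<=` M (theta t w).

(* L is the Fréchet derivative at x of f restricted to the subspace E. *)
Definition diff_on (E : set H) (f : H -> H) (x : H) (L : H -> H) : Prop :=
  forall e : R, 0 < e ->
    \forall v \near within E (nbhs x),
      `|f v - f x - L (v - x)| <= e * `|v - x|.

(* M is a Lipschitz center manifold, given as the graph of h ^~ w over E^c(w);
   the values of h outside E^c(w) are irrelevant. *)
Record center_manifold theta phi (W : set Omega) (M : Omega -> set H)
    (h : H -> Omega -> H) : Prop := CenterManifold {
  cm_random : random_set W M ;
  cm_invariant : forward_invariant theta phi W M ;
  cm_graph : forall w, W w -> M w = [set v + h v w | v in Ec w] ;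
  cm_codomain : forall w v, W w -> Ec w v -> set_sum (Eu w) (Es w) (h v w) ;
  cm_lipschitz : forall w, W w -> [lipschitz h v w | v in Ec w] ;
  cm_zero : forall w, W w -> h 0 w = 0 ;
  cm_tangent : forall w, W w ->
    diff_on (Ec w) (fun v => h v w) 0 (fun=> 0) ;
  cm_measurable : forall x : H,
    measurable_fun W (fun w => h (Pc w x) w : borel H)
}.

End Splitting.

Definition center_set phi (eta : R) : Omega -> set H :=
  fun w => [set u0 | C_eta eta (fun t => phi t u0 w)].

End RandomDynamicalSystems.

(* Main.v *)
(* The Lyapunov-Perron argument is carried out without integrals.  Along one
   orbit of the base flow put [w(t) = U(t)^-1 phi(t, x)]: uniform boundedness
   makes [U(t)] norm continuous at 0, so that [w] is differentiable with
   [w' = U^-1 B(U w)], and the mean value inequality applied to [U(t) P^k w]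
   replaces the variation of constants formula.  It bounds the difference of two
   trajectories on [-T, T] by its center part at time 0, its stable part at [-T]
   and its unstable part at [T].  The gap condition holds only pointwise in the
   orbit, with no uniform margin; the strict contraction, for [eta] and for some
   larger [eta1], comes from a gain in the estimate itself.
   Existence: the map sending [x] to the three boundary data on [-T, T] is
   bi-Lipschitz onto its image; it is onto for T = 0 and surjectivity propagates
   in T by the contraction principle.  Solutions of the boundary problems on
   [-n, n] are bounded in the [eta]-norm and Cauchy in the [eta1]-norm.
   Tangency uses Frechet differentiability of [phi] only at the two times [-n]
   and [n], and measurability follows by approximating the center projection and
   the points of the manifold by points of a countable dense set satisfying the
   boundary estimates at times [-n] and [n]. *)
From HB Require Import structures.
Require Import Defs.
From mathcomp Require Import ring lra.

Set Implicit Arguments.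
Unset Strict Implicit.
Unset Printing Implicit Defensive.
Local Open Scope classical_set_scope.
Local Open Scope ring_scope.

(** * The mean value inequality *)

(** Nothing is assumed on how [B] varies in time, so the derivative of [w] need not be continuous
    and the integrals of the Lyapunov-Perron equation are not at hand; the mean value inequality
    asks only for a derivative at each point. It lives on bounded intervals, so the problem is posed
    on [-T, T] with boundary data rather than on the whole line in [C_eta]. By invariance of [W] the
    gap condition holds at every [theta t w]. All it gives uniformly along the orbit is K(theta_t w)
    |B u - B v| <= kappa |u - v|, with [kappa] the inverse of the sum of the three inverse gaps: a
    contraction factor of exactly 1. The second exponent answers to the boundary data. Two
    trajectories bounded by C e^(eta |t|) may differ by that much at the times -n and n, and the
    projections there cost the tempered factors k(-n), k(n). Measured with [eta1], these
    contributions are damped by e^(-(eta1 - eta) n), which beats every tempered factor. *)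

Lemma is_derive1P (R : realType) (V : normedModType R) (f : R -> V) (t : R)
    (l : V) :
  is_derive t 1 f l <->
  forall e : R, 0 < e -> exists2 r : R, 0 < r &
    forall h, `|h| < r -> `|f (t + h) - f t - h *: l| <= e * `|h|.
Proof.
split.
- move=> [df <-] e e0.
  have /cvgrPdist_le /(_ e e0) := df.
  rewrite -[lim _]/('D_1 f t) => H.
  have {H} := H; rewrite /dnbhs near_withinE => H.
  apply/nbhs_norm0P; apply: filterS H => h /= Hh.
  have [->|h0] := eqVneq h 0.
    by rewrite addr0 subrr scale0r subr0 !normr0 mulr0.
  have := Hh h0.
  rewrite [_ *: 1]mulr1 (addrC h) distrC => H1.
  rewrite -ler_pdivrMr ?normr_gt0// -normfV mulrC -normrZ.
  rewrite scalerBr scalerA mulVf// scale1r.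
  exact: H1.
- move=> H.
  have K : (fun h => h^-1 *: ((f \o shift t) (h *: 1) - f t)) @ 0^' --> l.
    apply/cvgrPdist_le => e e0; rewrite /dnbhs near_withinE.
    have /nbhs_norm0P := H e e0; apply: filterS => h Hh h0 /=.
    rewrite [_ *: 1]mulr1 (addrC h) distrC.
    move: Hh; rewrite -ler_pdivrMr ?normr_gt0// -normfV mulrC -normrZ.
    by rewrite scalerBr scalerA mulVf// scale1r.
  split; first by apply/cvg_ex; exists l.
  exact: cvg_lim.
Qed.

Section inner_product.
Context {R : realType} {H : completeNormedModType R}.
Variable dot : {dot H for (@idfun R)}.
Hypothesis hdot : hilbert_product dot.

(** The squared norm of |y| x - |x| y expands to 2 |x| |y| (|x| |y| - dot x y), and it is
    nonnegative. *)
Lemma cauchy_schwarz x y : dot x y <= `|x| * `|y|.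
Proof.
have [->|x0] := eqVneq x 0; first by rewrite linear0l normr0 mul0r.
have [->|y0] := eqVneq y 0; first by rewrite linear0r normr0 mulr0.
have xy0 : 0 < `|x| * `|y| by rewrite mulr_gt0// normr_gt0.
have := sqr_ge0 `| `|y| *: x - `|x| *: y|.
rewrite hdot hnormB /= expr0 mul1r !linearZl_LR !linearZr_LR /= -!hdot.
set d := dot x y.
rewrite (_ : _ - _ = 2 * (`|x| * `|y|) * (`|x| * `|y| - d)).
  by rewrite pmulr_rge0 ?subr_ge0// mulr_gt0.
by rewrite /GRing.scale/=; ring.
Qed.

Lemma dot_abs_le x y : `|dot x y| <= `|x| * `|y|.
Proof.
rewrite ler_norml cauchy_schwarz andbT lerNl -linearNl -(normrN x).
exact: cauchy_schwarz.
Qed.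

(** Pairing with the increment [e] of [F] reduces the claim to the scalar mean value theorem for dot
    (F s) e - g s |e|, whose derivative is nonpositive by Cauchy-Schwarz. *)
Lemma mean_value_inequality (F DF : R -> H) (g dg : R -> R) (a b : R) :
  a <= b ->
  (forall s, a <= s <= b -> is_derive s 1 F (DF s)) ->
  (forall s, a <= s <= b -> is_derive s 1 g (dg s)) ->
  (forall s, a <= s <= b -> `|DF s| <= dg s) ->
  `|F b - F a| <= g b - g a.
Proof.
move=> ab dF dgP le_dF.
set e := F b - F a.
have dG s : a <= s <= b ->
    is_derive s 1 (fun s => dot (F s) e - g s * `|e|) (dot (DF s) e - dg s *
      `|e|).
  move=> sab; apply/is_derive1P => eps eps0.
  have e1 : 0 < eps / 2 / (`|e| + 1) by rewrite !divr_gt0// ltr_wpDl.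
  have /is_derive1P /(_ _ e1) [r1 r10 HF] := dF s sab.
  have /is_derive1P /(_ _ e1) [r2 r20 Hg] := dgP s sab.
  exists (Num.min r1 r2); first by rewrite lt_min r10.
  move=> h; rewrite lt_min => /andP[/HF h1 /Hg h2].
  rewrite (_ : _ - _ - _ = dot (F (s + h) - F s - h *: DF s) e -
    (g (s + h) - g s - h *: dg s) * `|e|); last first.
    by rewrite !linearBl /= linearZl_LR /GRing.scale/=; ring.
  apply: (le_trans (ler_normB _ _)).
  have cs := dot_abs_le (F (s + h) - F s - h *: DF s) e.
  rewrite normrM normr_id.
  have bnd (y : R) : y <= eps / 2 / (`|e| + 1) * `|h| -> y * `|e| <= eps / 2 *
    `|h|.
    move=> hy; apply: (le_trans (ler_wpM2r (normr_ge0 e) hy)).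
    rewrite mulrAC ler_wpM2r// mulrAC ler_pdivrMr ?ltr_wpDl//.
    by rewrite ler_wpM2l ?lerDl ?ler01// ltW// divr_gt0.
  have -> : eps * `|h| = eps / 2 * `|h| + eps / 2 * `|h|.
    by rewrite -mulrDl -splitr.
  rewrite lerD//.
    by apply: (le_trans cs); apply: bnd.
  exact: bnd.
have [] := @MVT_segment R (fun s => dot (F s) e - g s * `|e|)
   (fun s => dot (DF s) e - dg s * `|e|) a b ab.
- by move=> x; rewrite in_itv/= => /andP[x1 x2]; apply: dG; rewrite !ltW.
- apply: derivable_within_continuous => x; rewrite in_itv/= => xab.
  by have := dG x xab => -[].
- move=> c; rewrite in_itv/= => cab eG.
  have : dot (F b) e - g b * `|e| - (dot (F a) e - g a * `|e|) <= 0.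
    rewrite eG mulr_le0_ge0 ?subr_ge0// subr_le0.
    apply: (le_trans (cauchy_schwarz _ _)).
    by rewrite ler_wpM2r// le_dF.
  rewrite (_ : _ - _ = `|e| * (`|e| - (g b - g a))); last first.
    have : dot (F b) e - dot (F a) e = `|e| ^+ 2 by rewrite -linearBl hdot.
    lra.
  have [e0|e0] := ltrP 0 `|e|.
    by rewrite pmulr_rle0// subr_le0.
  move=> _; rewrite (le_trans e0)//.
  (* The increment of [F] vanishes here, and it remains to see that [g] does not decrease. *)
  have [] := @MVT_segment R g dg a b ab.
  + by move=> x; rewrite in_itv/= => /andP[x1 x2]; apply: dgP; rewrite !ltW.
  + apply: derivable_within_continuous => x; rewrite in_itv/= => xab.
    by have := dgP x xab => -[].
  + move=> c'; rewrite in_itv/= => cab' ->.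
    apply: mulr_ge0; last by rewrite subr_ge0.
    exact: le_trans (normr_ge0 _) (le_dF c' cab').
Qed.

End inner_product.

(** * The Lyapunov-Perron estimate *)

(* [mu] is a uniform lower bound for what the Lyapunov-Perron estimate gains
   over the sum of the three inverse gaps. *)
Record gap_condition (R : realType) (alpha beta gamma eta kappa q : R) : Prop :=
  GapCondition {
  gap_rates : [/\ 0 < gamma, gamma < eta, eta < alpha & eta < beta] ;
  gap_kappa : 0 <= kappa ;
  gap_gain : exists mu, [/\ mu <= (eta - gamma)^-1,
    mu <= (alpha - eta)^-1 - (alpha + eta)^-1,
    mu <= (beta - eta)^-1 - (beta + eta)^-1 &
    kappa * ((eta - gamma)^-1 + (beta - eta)^-1 + (alpha - eta)^-1 - mu) <= q]
}.

(** Reversing time exchanges the stable and the unstable rate; this symmetry reduces negative times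
    to positive ones. *)
Lemma gap_conditionC (R : realType) (alpha beta gamma eta kappa q : R) :
  gap_condition alpha beta gamma eta kappa q ->
  gap_condition beta alpha gamma eta kappa q.
Proof.
move=> [[g0 ge ea eb] k0 [mu [h1 h2 h3 h4]]]; split=> //.
by exists mu; split=> //; rewrite -(addrA (eta - gamma)^-1)
  (addrC (alpha - eta)^-1) addrA.
Qed.

Section lyapunov_perron_estimate.
Context {R : realType} {H : completeNormedModType R}.
Variable dot : {dot H for (@idfun R)}.
Hypothesis hdot : hilbert_product dot.

(** The mean value inequality against the antiderivative of the exponential. [r] may be negative, as
    it is for the unstable part, where the bound decays in [s]. *)
Lemma increment_le_expR (F DF : R -> H) (c p r a b : R) : r != 0 -> a <= b ->
  (forall s, a <= s <= b -> is_derive s 1 F (DF s)) ->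
  (forall s, a <= s <= b -> `|DF s| <= c * expR (p + r * s)) ->
  `|F b - F a| <= c * r^-1 * (expR (p + r * b) - expR (p + r * a)).
Proof.
move=> r0 ab dF bF; rewrite mulrBr.
apply: (mean_value_inequality hdot (DF := DF)
  (g := fun s => c * r^-1 * expR (p + r * s))
  (dg := fun s => c * expR (p + r * s))) => // s sab.
apply: is_derive_eq.
by rewrite /GRing.scale/=; field.
Qed.

Variables alpha beta gamma eta kappa q : R.
Hypothesis gap : gap_condition alpha beta gamma eta kappa q.

Lemma expR_gap_le (mu t : R) :
  mu <= (eta - gamma)^-1 -> mu <= (alpha - eta)^-1 - (alpha + eta)^-1 ->
  0 <= t ->
  (alpha - eta)^-1 * expR (- alpha * t)
  + (alpha + eta)^-1 * (expR (eta * t) - expR (- alpha * t))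
  + (eta - gamma)^-1 * (expR (eta * t) - expR (gamma * t))
  + (beta - eta)^-1 * expR (eta * t)
  <= expR (eta * t) *
     ((eta - gamma)^-1 + (beta - eta)^-1 + (alpha - eta)^-1 - mu).
Proof.
move=> mu_c mu_s t0; have [g0 ge ea eb] := gap_rates gap.
have XY : expR (- alpha * t) <= expR (eta * t).
  by rewrite ler_expR ler_wpM2r//; lra.
have YG : expR (- alpha * t) <= expR (gamma * t).
  by rewrite ler_expR ler_wpM2r//; lra.
have Y0 : 0 < expR (- alpha * t) by exact: expR_gt0.
have C0 : 0 < (eta - gamma)^-1 by rewrite invr_gt0; lra.
move: (expR (- alpha * t)) (expR (eta * t)) (expR (gamma * t)) XY YG Y0.
move: (alpha - eta)^-1 (alpha + eta)^-1 (eta - gamma)^-1 (beta - eta)^-1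
  mu_c mu_s C0 => A A' C B muC muA C0 Y X G XY YG Y0.
(* The difference of the two sides is (X - Y)(A - A' - mu) + (G - Y) C + Y (C - mu): the stable gain
   has weight X - Y, and the center gain has weight Y, which makes up for X - Y being small near t =
   0. *)
have h1 : 0 <= (X - Y) * (A - A' - mu) by apply: mulr_ge0; lra.
have h2 : 0 <= (G - Y) * C by apply: mulr_ge0; lra.
have h3 : 0 <= Y * (C - mu) by apply: mulr_ge0; lra.
lra.
Qed.

(* The summand [Fs] is estimated separately on [-T, 0] and on [0, t]: on the
   latter it gains the better exponent [alpha + eta].  At [t = 0], where
   nothing is gained, the term [Fc] vanishes instead.  Hence the gap condition,
   even in its limiting non-strict form, yields a uniform contraction. *)
Lemma lyapunov_perron_half (S T t bs bc bu : R) (Fs Fc Fu Ds Dc Du : R -> H) :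
  0 <= S -> 0 <= t <= T -> 0 <= bs -> 0 <= bc -> 0 <= bu ->
  (forall s, -T <= s <= T -> is_derive s 1 Fs (Ds s)) ->
  (forall s, -T <= s <= T -> is_derive s 1 Fc (Dc s)) ->
  (forall s, -T <= s <= T -> is_derive s 1 Fu (Du s)) ->
  (forall s, -T <= s <= t ->
    `|Ds s| <= kappa * S * (expR (- alpha * (t - s)) * expR (eta * `|s|))) ->
  (forall s, 0 <= s <= t ->
    `|Dc s| <= kappa * S * (expR (gamma * (t - s)) * expR (eta * `|s|))) ->
  (forall s, t <= s <= T ->
    `|Du s| <= kappa * S * (expR (beta * (t - s)) * expR (eta * `|s|))) ->
  `|Fs (- T)| <= expR (- alpha * (t + T)) * bs ->
  `|Fc 0| <= expR (gamma * t) * bc ->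
  `|Fu T| <= expR (beta * (t - T)) * bu ->
  `|Fs t + Fc t + Fu t| <=
    expR (eta * t) * (bc + expR (- eta * T) * (bs + bu) + q * S).
Proof.
have [g0 ge ea eb] := gap_rates gap; have kappa0 := gap_kappa gap.
move=> S0 /andP[t0 tT] bs0 bc0 bu0 dFs dFc dFu hs hc hu hbs hbc hbu.
have s1 : `|Fs 0 - Fs (- T)| <=
    kappa * S * (alpha - eta)^-1 * expR (- alpha * t).
  apply: le_trans
    (increment_le_expR (DF := Ds) (c := kappa * S) (p := - alpha * t)
      (r := alpha - eta) _ _ _ _) _.
  - by rewrite subr_eq0; lra.
  - lra.
  - by move=> s hh; apply: dFs; lra.
  - move=> s hh; have := hs s; rewrite -expRD => /(_ _)/le_trans; apply; first
    lra.
    apply: ler_wpM2l; first by rewrite mulr_ge0.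
    rewrite ler_expR ler0_norm; lra.
  - rewrite mulr0 addr0 ler_wpM2l//; last by rewrite gerBl expR_ge0.
    by rewrite !mulr_ge0// invr_ge0; lra.
have s2 : `|Fs t - Fs 0| <=
    kappa * S * (alpha + eta)^-1 * (expR (eta * t) - expR (- alpha * t)).
  apply: le_trans
    (increment_le_expR (DF := Ds) (c := kappa * S) (p := - alpha * t)
      (r := alpha + eta) _ _ _ _) _.
  - by apply: lt0r_neq0; lra.
  - lra.
  - by move=> s hh; apply: dFs; lra.
  - move=> s hh; have := hs s; rewrite -expRD => /(_ _)/le_trans; apply; first
    lra.
    apply: ler_wpM2l; first by rewrite mulr_ge0.
    rewrite ler_expR ger0_norm; lra.
  - by rewrite mulr0 addr0 (_ : - alpha * t + (alpha + eta) * t = eta * t)//;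
    ring.
have s3 : `|Fc t - Fc 0| <=
    kappa * S * (eta - gamma)^-1 * (expR (eta * t) - expR (gamma * t)).
  apply: le_trans
    (increment_le_expR (DF := Dc) (c := kappa * S) (p := gamma * t)
      (r := eta - gamma) _ _ _ _) _.
  - by apply: lt0r_neq0; lra.
  - lra.
  - by move=> s hh; apply: dFc; lra.
  - move=> s hh; have := hc s; rewrite -expRD => /(_ _)/le_trans; apply; first
    lra.
    apply: ler_wpM2l; first by rewrite mulr_ge0.
    rewrite ler_expR ger0_norm; lra.
  - by rewrite mulr0 addr0 (_ : gamma * t + (eta - gamma) * t = eta * t)//;
    ring.
have s4 : `|Fu T - Fu t| <= kappa * S * (beta - eta)^-1 * expR (eta * t).
  apply: le_trans
    (increment_le_expR (DF := Du) (c := kappa * S) (p := beta * t)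
      (r := - (beta - eta)) _ _ _ _) _.
  - by rewrite oppr_eq0; apply: lt0r_neq0; lra.
  - lra.
  - by move=> s hh; apply: dFu; lra.
  - move=> s hh; have := hu s; rewrite -expRD => /(_ _)/le_trans; apply; first
    lra.
    apply: ler_wpM2l; first by rewrite mulr_ge0.
    rewrite ler_expR ger0_norm; lra.
  - rewrite (_ : beta * t + - (beta - eta) * t = eta * t); last by ring.
    rewrite invrN mulrN mulNr -mulrN opprB ler_wpM2l//.
      by rewrite !mulr_ge0// invr_ge0; lra.
    by rewrite gerBl expR_ge0.
have b1 : `|Fs (- T)| <= expR (eta * t) * (expR (- eta * T) * bs).
  apply: (le_trans hbs); rewrite mulrA ler_wpM2r// -expRD ler_expR.
  have : 0 <= (alpha + eta) * t by apply: mulr_ge0; lra.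
  have : 0 <= (alpha - eta) * T by apply: mulr_ge0; lra.
  lra.
have b2 : `|Fc 0| <= expR (eta * t) * bc.
  by apply: (le_trans hbc); rewrite ler_wpM2r// ler_expR ler_wpM2r// ltW.
have b3 : `|Fu T| <= expR (eta * t) * (expR (- eta * T) * bu).
  apply: (le_trans hbu); rewrite mulrA ler_wpM2r// -expRD ler_expR.
  have : 0 <= (beta - eta) * (T - t) by apply: mulr_ge0; lra.
  lra.
have sum_le : kappa * S * ((alpha - eta)^-1 * expR (- alpha * t)
  + (alpha + eta)^-1 * (expR (eta * t) - expR (- alpha * t))
  + (eta - gamma)^-1 * (expR (eta * t) - expR (gamma * t))
  + (beta - eta)^-1 * expR (eta * t)) <= expR (eta * t) * (q * S).
  have [mu [mu_c mu_s _ kappa_q]] := gap_gain gap.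
  apply: (le_trans (ler_wpM2l (mulr_ge0 kappa0 S0) (expR_gap_le mu_c mu_s t0))).
  have := ler_wpM2l (mulr_ge0 (expR_ge0 (eta * t)) S0) kappa_q.
  lra.
have -> : Fs t + Fc t + Fu t = (Fs t - Fs 0) + (Fs 0 - Fs (- T)) + Fs (- T)
   + ((Fc t - Fc 0) + Fc 0) + (Fu T - (Fu T - Fu t)).
  by rewrite subrK subKr addrA !subrK.
have n1 := ler_normD ((Fs t - Fs 0) + (Fs 0 - Fs (- T)) + Fs (- T)
   + ((Fc t - Fc 0) + Fc 0)) (Fu T - (Fu T - Fu t)).
have n2 := ler_normD ((Fs t - Fs 0) + (Fs 0 - Fs (- T)) + Fs (- T))
   ((Fc t - Fc 0) + Fc 0).
have n3 := ler_normD ((Fs t - Fs 0) + (Fs 0 - Fs (- T))) (Fs (- T)).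
have n4 := ler_normD (Fs t - Fs 0) (Fs 0 - Fs (- T)).
have n5 := ler_normD (Fc t - Fc 0) (Fc 0).
have n6 := ler_normB (Fu T) (Fu T - Fu t).
lra.
Qed.

End lyapunov_perron_estimate.

Lemma is_derive_bounded_linear (R : realType) (V W : normedModType R)
    (G : {linear V -> W}) (C : R) (F : R -> V) (t : R) (l : V) :
  0 <= C -> (forall x, `|G x| <= C * `|x|) ->
  is_derive t 1 F l -> is_derive t 1 (fun s => G (F s)) (G l).
Proof.
move=> C0 GC /is_derive1P dF; apply/is_derive1P => e e0.
have C1 : 0 < C + 1 by rewrite ltr_wpDl.
have [r r0 hr] := dF (e / (C + 1)) (divr_gt0 e0 C1).
exists r => // h /hr hh.
rewrite -linearB -linearZ -linearB (le_trans (GC _))//.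
rewrite (le_trans (ler_wpM2l C0 hh))// mulrA ler_wpM2r//.
by rewrite mulrCA ler_piMr ?(ltW e0)// ler_pdivrMr// mul1r lerDl.
Qed.

Lemma is_derive_compN (R : realType) (V : normedModType R) (F : R -> V) (t : R)
    (l : V) :
  is_derive (- t) 1 F l -> is_derive t 1 (fun s => F (- s)) (- l).
Proof.
move=> /is_derive1P dF; apply/is_derive1P => e /dF[r r0 hr].
exists r => // h hh; have := hr (- h).
by rewrite normrN scaleNr opprK => /(_ hh); rewrite opprD scalerN opprK.
Qed.

Lemma is_derive1_continuous (R : realType) (V : normedModType R) (F DF : R ->
  V) :
  (forall t : R, is_derive t 1 F (DF t)) -> continuous F.
Proof.
move=> dF t; apply: differentiable_continuous.
by apply/derivable1_diffP; have [] := dF t.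
Qed.

(** * Trajectories along one orbit of the base flow *)

(* A random dynamical system seen along one orbit of the base flow: [U] and [V]
   are the linearized cocycle and its inverse, [f] the cocycle, [k] the constant
   of the trichotomy along the orbit. *)
Record trichotomous_orbit (R : realType) (H : completeNormedModType R)
    (U V : R -> {linear H -> H}) (f : R -> H -> H) (b : R -> H -> H)
    (Ps Pc Pu : {linear H -> H}) (k : R -> R)
    (alpha beta gamma kappa L : R) : Prop := TrichotomousOrbit {
  orbit_VU : forall t x, V t (U t x) = x ;
  orbit_UV : forall t x, U t (V t x) = x ;
  orbit_U0 : forall x, U 0 x = x ;
  orbit_bounded : forall N : R, exists2 C : R, 0 <= C &
    forall t x, `|t| <= N -> `|U t x| <= C * `|x| /\ `|V t x| <= C * `|x| ;
  orbit_0 : forall x, f 0 x = x ;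
  orbit_fixed : forall t, f t 0 = 0 ;
  orbit_ct : forall x, continuous (fun t => f t x) ;
  orbit_cx : forall t, continuous (f t) ;
  orbit_derive : forall x (t : R),
    is_derive t 1 (fun s => V s (f s x)) (V t (b t (f t x))) ;
  orbit_tangent : forall t e, 0 < e ->
    \forall x \near (0 : H), `|f t x - U t x| <= e * `|x| ;
  orbit_L0 : 0 <= L ;
  orbit_lipschitz : forall t x y, `|b t x - b t y| <= L * `|x - y| ;
  orbit_kappa : forall t x y, k t * `|b t x - b t y| <= kappa * `|x - y| ;
  orbit_split : forall x, Ps x + Pc x + Pu x = x ;
  orbit_ss : forall x, Ps (Ps x) = Ps x ;
  orbit_sc : forall x, Ps (Pc x) = 0 ;
  orbit_su : forall x, Ps (Pu x) = 0 ;
  orbit_cs : forall x, Pc (Ps x) = 0 ;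
  orbit_cc : forall x, Pc (Pc x) = Pc x ;
  orbit_cu : forall x, Pc (Pu x) = 0 ;
  orbit_us : forall x, Pu (Ps x) = 0 ;
  orbit_uc : forall x, Pu (Pc x) = 0 ;
  orbit_uu : forall x, Pu (Pu x) = Pu x ;
  orbit_k0 : forall t, 0 < k t ;
  orbit_tempered : forall d, 0 < d -> exists T : R, forall t, T <= `|t| ->
    k t <= expR (d * `|t|) ;
  orbit_s : forall t s x, s <= t ->
    `|U t (Ps (V s x))| <= k s * expR (- alpha * (t - s)) * `|x| ;
  orbit_c : forall t s x,
    `|U t (Pc (V s x))| <= k s * expR (gamma * `|t - s|) * `|x| ;
  orbit_u : forall t s x, t <= s ->
    `|U t (Pu (V s x))| <= k s * expR (beta * (t - s)) * `|x|
}.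

Section orbit_theory.
Context {R : realType} {H : completeNormedModType R}.
Variable dot : {dot H for (@idfun R)}.
Hypothesis hdot : hilbert_product dot.
Variables (U V : R -> {linear H -> H}) (f : R -> H -> H) (b : R -> H -> H).
Variables (Ps Pc Pu : {linear H -> H}) (k : R -> R).
Variables alpha beta gamma kappa L : R.
Hypothesis O : trichotomous_orbit U V f b Ps Pc Pu k alpha beta gamma kappa L.

Let w (x : H) (t : R) := V t (f t x).

Lemma orbit_V0 x : V 0 x = x.
Proof. by rewrite -{1}(orbit_U0 O x) (orbit_VU O). Qed.

Lemma orbit_w0 x : w x 0 = x.
Proof. by rewrite /w (orbit_0 O) orbit_V0. Qed.

Lemma orbit_Ps x : `|Ps x| <= k 0 * `|x|.
Proof.
have := orbit_s O (t := 0) (s := 0) x (lexx _).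
by rewrite orbit_V0 (orbit_U0 O) subrr mulr0 expR0 mulr1.
Qed.

Lemma orbit_Pc x : `|Pc x| <= k 0 * `|x|.
Proof.
have := orbit_c O 0 0 x.
by rewrite orbit_V0 (orbit_U0 O) subrr normr0 mulr0 expR0 mulr1.
Qed.

Lemma orbit_Pu x : `|Pu x| <= k 0 * `|x|.
Proof.
have := orbit_u O (t := 0) (s := 0) x (lexx _).
by rewrite orbit_V0 (orbit_U0 O) subrr mulr0 expR0 mulr1.
Qed.

Lemma orbit_UP_bounded (P : {linear H -> H}) t :
  (forall x, `|P x| <= k 0 * `|x|) ->
  exists2 C : R, 0 <= C & forall x, `|U t (P x)| <= C * `|x|.
Proof.
move=> hP; have [C C0 hC] := orbit_bounded O `|t|.
exists (C * k 0); first by rewrite mulr_ge0// ltW// (orbit_k0 O).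
move=> x; have [+ _] := hC t (P x) (lexx _).
by move=> /le_trans; apply; rewrite -mulrA ler_wpM2l.
Qed.

(** The time [t] is frozen, so U(t) P is a fixed bounded operator and only the transported
    trajectories are differentiated. *)
Lemma orbit_derive_diff (P : {linear H -> H}) x y t (s : R) :
  (forall x, `|P x| <= k 0 * `|x|) ->
  is_derive s 1 (fun r => U t (P (w x r - w y r)))
    (U t (P (V s (b s (f s x) - b s (f s y))))).
Proof.
move=> /(orbit_UP_bounded t)[C C0 hC].
have := @is_derive_bounded_linear _ _ _ (U t \o P)%FUN C
  (fun r => w x r - w y r) s _ C0 hC.
rewrite linearB; apply.
by apply: is_deriveB; exact: (orbit_derive O).
Qed.

Variables eta q : R.
Hypothesis gap : gap_condition alpha beta gamma eta kappa q.

(** A self-improving bound: a bound [S] on the difference in the [eta]-weighted norm over [-T, T]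
    comes back as [q * S] plus boundary data. *)
Lemma orbit_pointwise_estimate (S T bs bc bu t : R) (x y : H) :
  0 <= S -> 0 <= bs -> 0 <= bc -> 0 <= bu -> `|t| <= T ->
  (forall s, `|s| <= T -> `|f s x - f s y| <= S * expR (eta * `|s|)) ->
  `|U t (Ps (w x (- T) - w y (- T)))| <= expR (- alpha * (t + T)) * bs ->
  `|U t (Pc (x - y))| <= expR (gamma * `|t|) * bc ->
  `|U t (Pu (w x T - w y T))| <= expR (beta * (t - T)) * bu ->
  `|f t x - f t y| <=
    expR (eta * `|t|) * (bc + expR (- eta * T) * (bs + bu) + q * S).
Proof.
move=> S0 bs0 bc0 bu0 tT hS hbs hbc hbu.
have kb s : `|s| <= T -> k s * `|b s (f s x) - b s (f s y)| <=
    kappa * S * expR (eta * `|s|).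
  move=> sT; apply: (le_trans (orbit_kappa O _ _ _)).
  by rewrite -mulrA ler_wpM2l ?(gap_kappa gap)// hS.
have kb' s e : `|s| <= T ->
    k s * expR e * `|b s (f s x) - b s (f s y)| <=
    kappa * S * (expR e * expR (eta * `|s|)).
  move=> /kb/(ler_wpM2r (expR_ge0 e)).
  by rewrite mulrAC -(mulrA (kappa * S)) (mulrC (expR e)).
have hs s : s <= t -> `|s| <= T ->
   `|U t (Ps (V s (b s (f s x) - b s (f s y))))| <=
    kappa * S * (expR (- alpha * (t - s)) * expR (eta * `|s|)).
  by move=> st sT; apply: (le_trans (orbit_s O _ st)); exact: kb'.
have hc s : `|s| <= T ->
   `|U t (Pc (V s (b s (f s x) - b s (f s y))))| <=
    kappa * S * (expR (gamma * `|t - s|) * expR (eta * `|s|)).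
  by move=> sT; apply: (le_trans (orbit_c O _ _ _)); exact: kb'.
have hu s : t <= s -> `|s| <= T ->
   `|U t (Pu (V s (b s (f s x) - b s (f s y))))| <=
    kappa * S * (expR (beta * (t - s)) * expR (eta * `|s|)).
  by move=> st sT; apply: (le_trans (orbit_u O _ st)); exact: kb'.
have split : f t x - f t y = U t (Ps (w x t - w y t)) + U t (Pc (w x t - w y t))
    + U t (Pu (w x t - w y t)).
  by rewrite -!linearD (orbit_split O) linearB /w !(orbit_UV O).
rewrite split; move: tT; rewrite ler_norml => /andP[tT1 tT2].
have [t0|t0] := leP 0 t.
- rewrite ger0_norm//; rewrite ger0_norm// in hbc.
  apply: (lyapunov_perron_half hdot gap (T := T)
   (Fs := fun s => U t (Ps (w x s - w y s)))
   (Fc := fun s => U t (Pc (w x s - w y s)))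
   (Fu := fun s => U t (Pu (w x s - w y s)))
   (Ds := fun s => U t (Ps (V s (b s (f s x) - b s (f s y)))))
   (Dc := fun s => U t (Pc (V s (b s (f s x) - b s (f s y)))))
   (Du := fun s => U t (Pu (V s (b s (f s x) - b s (f s y)))))) => //.
  + by rewrite t0.
  + by move=> s _; apply: orbit_derive_diff; exact: orbit_Ps.
  + by move=> s _; apply: orbit_derive_diff; exact: orbit_Pc.
  + by move=> s _; apply: orbit_derive_diff; exact: orbit_Pu.
  + by move=> s /andP[s1 s2]; apply: hs => //; rewrite ler_norml; lra.
  + move=> s /andP[s1 s2]; rewrite -[t - s]ger0_norm ?subr_ge0//.
    by apply: hc; rewrite ler_norml; lra.
  + by move=> s /andP[s1 s2]; apply: hu => //; rewrite ler_norml; lra.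
  + by rewrite !orbit_w0.
(* For negative [t], time is reversed: the unstable part takes the role of the stable one and the
   two boundary terms change places. *)
- rewrite ltr0_norm//; rewrite ltr0_norm// in hbc.
  rewrite (addrC (U t (Ps _) + _)) (addrC (U t (Ps _))) addrA (addrC bs).
  have := (lyapunov_perron_half hdot (gap_conditionC gap) (T := T) (t := - t)
   (S := S) (bs := bu) (bc := bc) (bu := bs)
   (Fs := fun s => U t (Pu (w x (- s) - w y (- s))))
   (Fc := fun s => U t (Pc (w x (- s) - w y (- s))))
   (Fu := fun s => U t (Ps (w x (- s) - w y (- s))))
   (Ds := fun s => - U t (Pu (V (- s) (b (- s) (f (- s) x) - b (- s) (f (- s)
     y)))))
   (Dc := fun s => - U t (Pc (V (- s) (b (- s) (f (- s) x) - b (- s) (f (- s)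
     y)))))
   (Du := fun s => - U t (Ps (V (- s) (b (- s) (f (- s) x) - b (- s) (f (- s)
     y)))))).
  rewrite !opprK; apply => //.
  + by apply/andP; split; lra.
  + move=> s _; apply: (@is_derive_compN _ _ (fun s => U t (Pu (w x s - w y
    s)))).
    by apply: orbit_derive_diff; exact: orbit_Pu.
  + move=> s _; apply: (@is_derive_compN _ _ (fun s => U t (Pc (w x s - w y
    s)))).
    by apply: orbit_derive_diff; exact: orbit_Pc.
  + move=> s _; apply: (@is_derive_compN _ _ (fun s => U t (Ps (w x s - w y
    s)))).
    by apply: orbit_derive_diff; exact: orbit_Ps.
  + move=> s /andP[s1 s2]; rewrite normrN -(normrN s).
    rewrite (_ : - beta * (- t - s) = beta * (t - - s)); last by ring.
    by apply: hu; [lra|rewrite normrN ler_norml; lra].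
  + move=> s /andP[s1 s2]; rewrite normrN -(normrN s).
    rewrite (_ : - t - s = `|t - - s|); last by rewrite opprK ler0_norm; lra.
    by apply: hc; rewrite normrN ler_norml; lra.
  + move=> s /andP[s1 s2]; rewrite normrN -(normrN s).
    rewrite (_ : alpha * (- t - s) = - alpha * (t - - s)); last by ring.
    by apply: hs; [lra|rewrite normrN ler_norml; lra].
  + by rewrite (_ : - beta * (- t + T) = beta * (t - T))//; ring.
  + by rewrite oppr0 !orbit_w0.
  + by rewrite (_ : alpha * (- t - T) = - alpha * (t + T))//; ring.
Qed.

Hypothesis q1 : q < 1.

(** Orbits are continuous, so the weighted difference attains its maximum on [-T, T]. With this
    maximum as [S], the term [q * S] is absorbed on the left. *)
Lemma orbit_estimate (T bs bu : R) (x y : H) :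
  0 <= T -> 0 <= bs -> 0 <= bu ->
  (forall t, `|t| <= T ->
    `|U t (Ps (w x (- T) - w y (- T)))| <= expR (- alpha * (t + T)) * bs) ->
  (forall t, `|t| <= T ->
    `|U t (Pu (w x T - w y T))| <= expR (beta * (t - T)) * bu) ->
  forall t, `|t| <= T ->
  (1 - q) * `|f t x - f t y| <=
    expR (eta * `|t|) * (k 0 * `|Pc (x - y)| + expR (- eta * T) * (bs + bu)).
Proof.
move=> T0 bs0 bu0 hbs hbu t tT.
pose Z s := expR (- eta * `|s|) * `|f s x - f s y|.
have cZ : continuous Z.
  move=> s; apply: cvgM.
    apply: (@continuous_comp _ _ _ (fun s => - eta * `|s|) expR).
      by apply: cvgMr; exact: norm_continuous.
    exact: continuous_expR.
  apply: cvg_norm; apply: cvgB; exact: (orbit_ct O).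
have [||s sT maxs] := @EVT_max _ Z (- T) T.
- by rewrite ge0_cp.
- exact: continuous_subspaceT.
have Z0 : 0 <= Z s by rewrite mulr_ge0 ?expR_ge0.
have ZE r : `|f r x - f r y| = Z r * expR (eta * `|r|).
  by rewrite /Z mulrAC -expRD mulNr addNr expR0 mul1r.
have := @orbit_pointwise_estimate (Z s) T bs (k 0 * `|Pc (x - y)|) bu s x y.
have sT' : `|s| <= T by move: sT; rewrite in_itv/= ler_norml.
have Pc0 : 0 <= k 0 * `|Pc (x - y)| by rewrite mulr_ge0 ?(ltW (orbit_k0 O _)).
move=> /(_ Z0 bs0 Pc0 bu0 sT') H1.
have {H1} : `|f s x - f s y| <= expR (eta * `|s|) *
    (k 0 * `|Pc (x - y)| + expR (- eta * T) * (bs + bu) + q * Z s).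
  apply: H1.
  - move=> r rT; rewrite ZE ler_wpM2r ?expR_ge0//; apply: maxs.
    by rewrite in_itv/= -ler_norml.
  - exact: hbs.
  (* The center bound is applied to [Pc (x - y)], not to [x - y], so that by idempotence only the
     center part of the difference enters. *)
  - have := orbit_c O s 0 (Pc (x - y)).
    by rewrite orbit_V0 (orbit_cc O) subr0 mulrAC mulrC.
  - exact: hbu.
rewrite {1}ZE mulrC ler_pM2l ?expR_gt0// => hZ.
have tT' : t \in `[- T, T] by rewrite in_itv/= -ler_norml.
have := maxs t tT' => hts.
rewrite ZE mulrA mulrC ler_wpM2l ?expR_ge0//.
have h1 : 0 <= (1 - q) * (Z s - Z t) by rewrite mulr_ge0 ?subr_ge0// ltW.
lra.
Qed.

End orbit_theory.

(** * The boundary value problem on a finite interval *)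

Lemma is_derive_affine (R : realType) (V : normedModType R) (F : R -> V)
    (a c s : R) (l : V) :
  is_derive (a + s * c) 1 F l -> is_derive s 1 (fun r => F (a + r * c)) (c *:
    l).
Proof.
move=> /is_derive1P dF; apply/is_derive1P => e e0.
have c1 : 0 < `|c| + 1 by rewrite ltr_wpDl.
have [r r0 hr] := dF (e / (`|c| + 1)) (divr_gt0 e0 c1).
exists (r / (`|c| + 1)); first exact: divr_gt0.
move=> h; rewrite ltr_pdivlMr// => hh.
rewrite mulrDl addrA scalerA (le_trans (hr (h * c) _))//.
  rewrite normrM (le_lt_trans _ hh)// ler_wpM2l// lerDl//.
have -> : e / (`|c| + 1) * `|h * c| = e * `|h| * (`|c| / (`|c| + 1)).
  by rewrite normrM; ring.
rewrite ler_piMr ?mulr_ge0 ?(ltW e0)//.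
by rewrite ler_pdivrMr// mul1r lerDl.
Qed.

Lemma half_contraction_fixpoint (R : realType) (H : completeNormedModType R)
    (g : H -> H) :
  (forall x y, `|g x - g y| <= 2^-1 * `|x - y|) -> exists x, g x = x.
Proof.
move=> hg.
have gfun : set_fun [set: H] [set: H] g by [].
pose G : {fun [set: H] >-> [set: H]} := HB.pack g (isFun.Build _ _ _ _ _ gfun).
have [|||x _ xE] := @banach_fixed_point R H setT G.
- exists (2^-1)%:nng; split => /=; first by rewrite invf_lt1// ltr1n.
  by move=> [x y] _ /=; exact: hg.
- exact: closedT.
- by exists 0.
- by exists x; rewrite [RHS]xE.
Qed.

Section orbit_shooting.
Context {R : realType} {H : completeNormedModType R}.
Variable dot : {dot H for (@idfun R)}.
Hypothesis hdot : hilbert_product dot.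
Variables (U V : R -> {linear H -> H}) (f : R -> H -> H) (b : R -> H -> H).
Variables (Ps Pc Pu : {linear H -> H}) (k : R -> R).
Variables alpha beta gamma kappa L : R.
Hypothesis O : trichotomous_orbit U V f b Ps Pc Pu k alpha beta gamma kappa L.

Let w (x : H) (t : R) := V t (f t x).

(** A short-time substitute for Gronwall. On the segment from [s] to [t], rescaled to [0, 1], the
    largest norm of the difference is at most its norm at [s] plus half of itself, hence at most
    twice its norm at [s]. The rescaling covers both orders of [s] and [t]. *)
Lemma orbit_flow_lipschitz (N : R) : exists2 C : R, 0 <= C &
  forall x y s t, `|s| <= N -> `|t| <= N -> C * `|t - s| <= 2^-1 ->
  `|(w x t - w y t) - (w x s - w y s)| <= C * `|t - s| * 2 * `|w x s - w y s|.
Proof.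
have [C C0 hC] := orbit_bounded O N; have L0 := orbit_L0 O.
exists (C * L * C); first by rewrite !mulr_ge0.
move=> x y s t sN tN hst.
pose F r := w x (s + r * (t - s)) - w y (s + r * (t - s)).
pose DF r := (t - s) *: V (s + r * (t - s))
  (b (s + r * (t - s)) (f (s + r * (t - s)) x) -
   b (s + r * (t - s)) (f (s + r * (t - s)) y)).
have dF (r : R) : is_derive r 1 F (DF r).
  apply: (@is_derive_affine _ _ (fun u => w x u - w y u)).
  by rewrite linearB; apply: is_deriveB; exact: (orbit_derive O).
have cF : continuous F by exact: (is_derive1_continuous dF).
have bF r : 0 <= r <= 1 -> `|DF r| <= C * L * C * `|t - s| * `|F r|.
  move=> /andP[r0 r1]; rewrite /DF normrZ.
  have rN : `|s + r * (t - s)| <= N.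
    rewrite (_ : _ + _ = (1 - r) * s + r * t); last by ring.
    rewrite (le_trans (ler_normD _ _))// !normrM (ger0_norm r0).
    rewrite ger0_norm ?subr_ge0//.
    have h1 : 0 <= (1 - r) * (N - `|s|) by rewrite mulr_ge0 ?subr_ge0.
    have h2 : 0 <= r * (N - `|t|) by rewrite mulr_ge0 ?subr_ge0.
    lra.
  rewrite /F; set u := s + _ in rN *.
  have [_ h1] := hC u (b u (f u x) - b u (f u y)) rN.
  have [h2 _] := hC u (w x u - w y u) rN.
  rewrite [in X in X <= _]linearB /w !(orbit_UV O) in h2.
  have h3 := orbit_lipschitz O u (f u x) (f u y).
  rewrite [leRHS]mulrAC mulrC ler_wpM2r//.
  rewrite (le_trans h1)// -mulrA -mulrA ler_wpM2l// (le_trans h3)//.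
  by rewrite -mulrA ler_wpM2l.
have [||m m01 maxm] := @EVT_max _ (fun r => `|F r|) 0 1.
- exact: ler01.
- by apply: continuous_subspaceT => r; apply: cvg_norm; exact: cF.
have incr r : 0 <= r <= 1 -> `|F r - F 0| <= C * L * C * `|t - s| * `|F m| * r.
  move=> /andP[r0 r1].
  set K := C * L * C * `|t - s| * `|F m|.
  have -> : K * r = K * r - K * 0 by rewrite mulr0 subr0.
  apply: (mean_value_inequality hdot (DF := DF)
    (g := fun r => K * r) (dg := fun=> K)) => // u /andP[u0 ur].
    apply: is_derive_eq; by rewrite /GRing.scale/= mulr1.
  have u1 : 0 <= u <= 1 by rewrite u0 (le_trans ur).
  rewrite (le_trans (bF u u1))// ler_wpM2l//.
    by rewrite !mulr_ge0.
  by apply: maxm; rewrite in_itv.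
have m01' : 0 <= m <= 1 by move: m01; rewrite in_itv.
have F0 : F 0 = w x s - w y s by rewrite /F mul0r addr0.
have F1 : F 1 = w x t - w y t by rewrite /F mul1r subrKC.
have Fm : `|F m| <= 2 * `|F 0|.
  have h1 := incr m m01'.
  have h2 : C * L * C * `|t - s| * `|F m| * m <= 2^-1 * `|F m|.
    case/andP: m01' => m0 m1.
    rewrite -mulrA; apply: ler_pM => //; first by rewrite !mulr_ge0.
      by rewrite mulr_ge0.
    by rewrite ler_piMr.
  have h3 : `|F m| <= `|F m - F 0| + `|F 0| by rewrite -{1}(subrK (F 0) (F m))
    ler_normD.
  lra.
rewrite -F1 -F0 (le_trans (incr 1 _))// ?ler01 ?lexx// mulr1.
by rewrite -[leRHS]mulrA ler_wpM2l// !mulr_ge0.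
Qed.

Variables eta q : R.
Hypothesis gap : gap_condition alpha beta gamma eta kappa q.
Hypothesis q1 : q < 1.

(* [shooting T x = v] prescribes the center part of [x] at time 0, and the
   stable and unstable parts of its trajectory at times [- T] and [T], both
   transported to time 0 by the linear flow. *)
Let shooting T x := Pc x + Ps (w x (- T)) + Pu (w x T).

Lemma Pc_shooting T x : Pc (shooting T x) = Pc x.
Proof.
by rewrite /shooting !linearD (orbit_cc O) (orbit_cs O) (orbit_cu O) !addr0.
Qed.

Lemma Ps_shooting T x : Ps (shooting T x) = Ps (w x (- T)).
Proof.
by rewrite /shooting !linearD (orbit_sc O) (orbit_ss O) (orbit_su O) add0r
  addr0.
Qed.

Lemma Pu_shooting T x : Pu (shooting T x) = Pu (w x T).
Proof.
by rewrite /shooting !linearD (orbit_uc O) (orbit_us O) (orbit_uu O) !add0r.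
Qed.

(** The constant depends on [N] but not on [T]; this is what gives the continuation in [T] a step
    length bounded from below. *)
Lemma shooting_expansive (N : R) : exists2 C : R, 0 <= C &
  forall T x y t, 0 <= T <= N -> `|t| <= T ->
  `|f t x - f t y| <= C * `|shooting T x - shooting T y|.
Proof.
have [g0 ge ea eb] := gap_rates gap.
have [C C0 hC] := orbit_bounded O N.
have k0 := orbit_k0 O 0.
(* [orbit_estimate] wants boundary terms that decay in t + T and in T - t. Both are at most 2 N, so
   a crude exponential factor pays for the decay. *)
pose Cs := expR (2 * alpha * N) * (C * k 0).
pose Cu := expR (2 * beta * N) * (C * k 0).
have Cs0 : 0 <= Cs by rewrite !mulr_ge0 ?expR_ge0 ?(ltW k0).
have Cu0 : 0 <= Cu by rewrite !mulr_ge0 ?expR_ge0 ?(ltW k0).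
exists ((1 - q)^-1 * (expR (eta * N) * (k 0 * k 0 + (Cs + Cu)))).
  rewrite !mulr_ge0 ?expR_ge0 ?invr_ge0 ?subr_ge0 ?(ltW q1)//.
  by rewrite !addr_ge0// mulr_ge0// ltW.
move=> T x y t /andP[T0 TN] tT.
set D := shooting T x - shooting T y.
have UD r (P : {linear H -> H}) : (forall x, `|P x| <= k 0 * `|x|) -> `|r| <= N
  ->
    `|U r (P D)| <= C * k 0 * `|D|.
  move=> hP rN; have [+ _] := hC r (P D) rN.
  by move=> /le_trans; apply; rewrite -mulrA ler_wpM2l.
have := @orbit_estimate _ _ _ hdot _ _ _ _ _ _ _ _ _ _ _ _ _ O _ _ gap q1 T
  (Cs * `|D|) (Cu * `|D|) x y T0.
move=> /(_ (mulr_ge0 Cs0 (normr_ge0 _)) (mulr_ge0 Cu0 (normr_ge0 _))) est.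
rewrite -mulrA mulrC ler_pdivlMr ?subr_gt0// mulrC.
apply: (le_trans (est _ _ t tT)).
- move=> r rT; rewrite linearB -!Ps_shooting -linearB -/D.
  have rN := le_trans rT TN.
  rewrite (le_trans (UD r Ps (orbit_Ps O) rN))//.
  rewrite /Cs !mulrA -expRD -!mulrA ler_peMl ?mulr_ge0 ?(ltW k0)//.
  rewrite -[X in X <= _]expR0 ler_expR; move: rT; rewrite ler_norml => /andP[r1
    r2].
  have h : 0 <= alpha * (2 * N - r - T) by rewrite mulr_ge0//; lra.
  lra.
- move=> r rT; rewrite linearB -!Pu_shooting -linearB -/D.
  have rN := le_trans rT TN.
  rewrite (le_trans (UD r Pu (orbit_Pu O) rN))//.
  rewrite /Cu !mulrA -expRD -!mulrA ler_peMl ?mulr_ge0 ?(ltW k0)//.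
  rewrite -[X in X <= _]expR0 ler_expR; move: rT; rewrite ler_norml => /andP[r1
    r2].
  have h : 0 <= beta * (2 * N + r - T) by rewrite mulr_ge0//; lra.
  lra.
rewrite -[leRHS]mulrA; apply: ler_pM.
- exact: expR_ge0.
- rewrite addr_ge0 ?mulr_ge0 ?expR_ge0 ?(ltW k0)//.
  by apply: addr_ge0; apply: mulr_ge0.
- by rewrite ler_expR ler_wpM2l ?(le_trans tT)//; lra.
rewrite mulrDl lerD//.
  rewrite -mulrA ler_wpM2l ?(ltW k0)// linearB -(Pc_shooting T x) -(Pc_shooting
    T y) -linearB.
  exact: (orbit_Pc O).
rewrite -mulrDl ler_piMl// ?mulr_ge0 ?addr_ge0//.
rewrite -[X in _ <= X]expR0 ler_expR mulNr oppr_le0 mulr_ge0//; lra.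
Qed.

(** Let [r] be a right inverse of [shooting T] and [p] the increment of the shooting map from [T] to
    [T']. Then [r xi] has data [v] at [T'] exactly when xi = v - p (r xi), and for T' - T small this
    is a fixed point equation for a contraction. *)
Lemma shooting_step (N : R) : exists2 d : R, 0 < d &
  forall T T', 0 <= T -> T <= T' <= N -> T' - T <= d ->
  (forall v, exists x, shooting T x = v) ->
  forall v, exists x, shooting T' x = v.
Proof.
have k0 := orbit_k0 O 0.
have [C C0 hC] := orbit_bounded O N.
have [L1 L10 hL] := orbit_flow_lipschitz N.
have [E E0 hE] := shooting_expansive N.
(* The stable and the unstable increment each contribute 2 k(0) L1 C E per unit of time. *)
pose K := 4 * (k 0 * L1 * C * E).
have K0 : 0 <= K by rewrite !mulr_ge0// ltW.
have KL0 : 0 < 2 * (K + L1 + 1).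
  by rewrite mulr_gt0// ltr_wpDl// addr_ge0.
(* This makes both [K * (T' - T)] and [L1 * (T' - T)] at most 1/2; the summand 1 keeps the
   denominator positive. *)
exists (2 * (K + L1 + 1))^-1; first by rewrite invr_gt0.
move=> T T' T0 /andP[TT' T'N] hd surj v.
have dK : K * (T' - T) <= 2^-1.
  rewrite -(ler_pM2l (ltr0n _ 2 : 0 < 2%:R)) mulfV// mulrA.
  rewrite (@le_trans _ _ (2 * (K + L1 + 1) * (T' - T)))//.
    by rewrite ler_wpM2r ?subr_ge0// ler_wpM2l// -addrA lerDl addr_ge0.
  by rewrite -ler_pdivlMl// mulr1.
have dL : L1 * (T' - T) <= 2^-1.
  rewrite -(ler_pM2l (ltr0n _ 2 : 0 < 2%:R)) mulfV// mulrA.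
  rewrite (@le_trans _ _ (2 * (K + L1 + 1) * (T' - T)))//.
    by rewrite ler_wpM2r ?subr_ge0// ler_wpM2l// addrAC lerDr addr_ge0.
  by rewrite -ler_pdivlMl// mulr1.
pose p x := shooting T' x - shooting T x.
have [r rE] := choice surj.
have TN : `|T| <= N by rewrite ger0_norm// (le_trans TT').
have T'N' : `|T'| <= N by rewrite ger0_norm// (le_trans T0).
have hw x y t : `|t| <= T -> `|w x t - w y t| <=
    C * (E * `|shooting T x - shooting T y|).
  move=> tT; have tN : `|t| <= N by rewrite (le_trans tT)// (le_trans TT').
  have [_] := hC t (f t x - f t y) tN; rewrite linearB => /le_trans; apply.
  by rewrite ler_wpM2l// hE// T0 (le_trans TT').
have pl x y : `|p x - p y| <= 2^-1 * `|shooting T x - shooting T y|.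
  have pE z : p z = Ps (w z (- T') - w z (- T)) + Pu (w z T' - w z T).
    by rewrite /p /shooting opprD addrACA (opprD (Pc z)) (addrACA (Pc z)) subrr
      add0r -!linearB.
  have -> : p x - p y =
     Ps ((w x (- T') - w y (- T')) - (w x (- T) - w y (- T))) +
     Pu ((w x T' - w y T') - (w x T - w y T)).
    have sub4 (a1 a2 a3 a4 : H) : (a1 - a2) - (a3 - a4) = (a1 - a3) - (a2 - a4).
      by rewrite (opprD a3) addrACA -opprD.
    by rewrite !pE opprD addrACA -(raddfB Ps) -(raddfB Pu) sub4 (sub4 (w x T')).
  have eT : `|- T' - - T| = T' - T.
    by rewrite -opprD normrN ger0_norm// subr_ge0.
  have eT' : `|T' - T| = T' - T by rewrite ger0_norm// subr_ge0.
  have h1 := hL x y (- T) (- T'); rewrite !normrN eT in h1.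
  have h2 := hL x y T T'; rewrite eT' in h2.
  set D := `|shooting T x - shooting T y|.
  have hD z : z <= C * (E * D) -> L1 * (T' - T) * 2 * z <= (L1 * (T' - T) * 2 *
    (C * E)) * D.
    move=> hz; rewrite -[leRHS]mulrA ler_wpM2l -?mulrA// !mulr_ge0//
      ?subr_ge0//.
  have b1 := hD _ (hw x y (- T) _); have b2 := hD _ (hw x y T _).
  rewrite normrN ger0_norm// in b1; rewrite ger0_norm// in b2.
  rewrite (le_trans (ler_normD _ _))//.
  apply: (le_trans (lerD (orbit_Ps O _) (orbit_Pu O _))).
  rewrite -mulrDr.
  have := ler_wpM2l (ltW k0) (lerD (le_trans (h1 TN T'N' dL) (b1 (lexx _)))
    (le_trans (h2 TN T'N' dL) (b2 (lexx _)))).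
  move=> /le_trans; apply.
  have := ler_wpM2r (normr_ge0 (shooting T x - shooting T y)) dK.
  rewrite -/D /K; lra.
have hg x y : `|(v - p (r x)) - (v - p (r y))| <= 2^-1 * `|x - y|.
  rewrite [X in `|X|](_ : _ = p (r y) - p (r x)); last first.
    by move: (p (r x)) (p (r y)) => p1 p2; rewrite opprB addrC addrA subrK.
  rewrite distrC.
  by rewrite (le_trans (pl _ _))// !rE.
have [xi xiE] := half_contraction_fixpoint hg.
exists (r xi); rewrite -[LHS](subrK (shooting T (r xi))) -/(p _) rE.
by rewrite -{2}xiE subrKC.
Qed.

Lemma shooting_surjective (N : R) v : 0 <= N -> exists x, shooting N x = v.
Proof.
move=> N0; have [d d0 step] := shooting_step N.
pose m := (Num.truncn (N / d)).+1.
have m0 : 0 < m%:R :> R by rewrite ltr0n.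
have md : N / m%:R <= d.
  rewrite ler_pdivrMr// mulrC -ler_pdivrMr// ltW//.
  exact: truncnS_gt.
suff surj (j : nat) : (j <= m)%N -> forall v, exists x, shooting (j%:R * (N /
  m%:R)) x = v.
  have [x xE] := surj m (leqnn _) v; exists x.
  by rewrite -xE mulrCA mulfV ?mulr1// gt_eqF.
elim: j => [_ {}v|j IH jm].
  exists v; rewrite mul0r /shooting /w oppr0 !(orbit_w0 O) (addrC (Pc v)).
  exact: (orbit_split O).
have h0 : 0 <= N / m%:R by rewrite divr_ge0// ltW.
apply: step (IH (ltnW jm)).
- by rewrite mulr_ge0.
- rewrite ler_wpM2r ?ler_nat//= mulrCA ler_piMr// ler_pdivrMr// mul1r ler_nat//.
- by rewrite -mulrBl -natrB// subSnn mul1r.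
Qed.

End orbit_shooting.

(** * Slowly growing trajectories *)

Lemma tempered_tail (R : realType) (k : R -> R) (rho e : R) :
  (forall t, 0 < k t) ->
  (forall d, 0 < d -> exists T : R, forall t, T <= `|t| -> k t <= expR (d *
    `|t|)) ->
  0 < rho -> 0 < e ->
  exists N : nat, forall n, (N <= n)%N ->
    expR (- rho * n%:R) * (k (- n%:R) + k n%:R) <= e.
Proof.
move=> k0 temp rho0 e0; have [T hT] := temp (rho / 2) (divr_gt0 rho0 (ltr0n _
  2)).
(* Temperedness is used at half the rate. Past 4 / (rho e) the remaining factor e^(-rho n / 2) is at
   most e / 2, because e^x >= x, and there are two terms. *)
pose M := Num.max T (4 / (rho * e)).
exists (Num.truncn M).+1 => n Nn.
have Mn : M < n%:R by rewrite (lt_le_trans (truncnS_gt M))// ler_nat.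
move: Mn; rewrite gt_max => /andP[/ltW Tn en].
have n0 : 0 < n%:R :> R by rewrite (lt_trans _ en)// divr_gt0// mulr_gt0.
have h1 := hT n%:R; have h2 := hT (- n%:R).
rewrite normrN !(ger0_norm (ltW n0)) in h1 h2.
have {}h1 := h1 Tn; have {}h2 := h2 Tn.
have h3 := lerD h2 h1.
apply: (le_trans (ler_wpM2l (expR_ge0 _) h3)).
rewrite mulrDr -expRD (_ : - rho * n%:R + _ = - (rho / 2 * n%:R)); last by
  field.
have h4 : rho / 2 * n%:R <= expR (rho / 2 * n%:R).
  by rewrite (le_trans _ (expR_ge1Dx _))// lerDr.
have h5 : 0 < rho / 2 * n%:R by rewrite mulr_gt0// divr_gt0.
rewrite expRN.
have h6 : (expR (rho / 2 * n%:R))^-1 <= e / 2.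
  rewrite (@le_trans _ _ (rho / 2 * n%:R)^-1)//.
    by rewrite lef_pV2// posrE expR_gt0.
  rewrite invf_ple ?posrE ?divr_gt0//.
  move: en; rewrite ltr_pdivrMr ?mulr_gt0// => en.
  by rewrite invf_div ler_pdivrMr//; lra.
lra.
Qed.

Lemma linear_le_continuous (R : realType) (V W : normedModType R)
    (G : {linear V -> W}) (C : R) :
  0 <= C -> (forall x, `|G x| <= C * `|x|) -> continuous G.
Proof.
move=> C0 hC x; apply/cvgrPdist_le => e e0.
have C1 : 0 < C + 1 by rewrite ltr_wpDl.
apply: filterS (nbhsx_ballx x _ (divr_gt0 e0 C1)) => y.
rewrite -ball_normE /ball_ /= => xy.
rewrite -linearB (le_trans (hC _))// (le_trans (ler_wpM2l C0 (ltW xy)))//.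
by rewrite mulrCA ler_piMr ?(ltW e0)// ler_pdivrMr// mul1r lerDl.
Qed.

Section orbit_center.
Context {R : realType} {H : completeNormedModType R}.
Variable dot : {dot H for (@idfun R)}.
Hypothesis hdot : hilbert_product dot.
Variables (U V : R -> {linear H -> H}) (f : R -> H -> H) (b : R -> H -> H).
Variables (Ps Pc Pu : {linear H -> H}) (k : R -> R).
Variables alpha beta gamma kappa L : R.
Hypothesis O : trichotomous_orbit U V f b Ps Pc Pu k alpha beta gamma kappa L.
Variables eta eta1 q : R.
Hypothesis gap : gap_condition alpha beta gamma eta kappa q.
Hypothesis gap1 : gap_condition alpha beta gamma eta1 kappa q.
Hypothesis eta_lt : eta < eta1.
Hypothesis q1 : q < 1.

Definition slow_orbit x := exists C, forall t, `|f t x| <= C * expR (eta *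
  `|t|).

(** The size, in the [eta1]-norm, of the boundary terms of two trajectories known only to be of
    order e^(eta n) at the times -n and n. *)
Let tail (n : nat) := expR (- (eta1 - eta) * n%:R) * (k (- n%:R) + k n%:R).

(** The growth bounds are asked for at the two end times only. This lets the estimate apply to
    arbitrary points that pass two norm tests, as the measurability proof requires. *)
Lemma slow_segment_estimate (n : nat) (C : R) x y : 0 <= C ->
  `|f n%:R x| <= C * expR (eta * n%:R) ->
  `|f (- n%:R) x| <= C * expR (eta * n%:R) ->
  `|f n%:R y| <= C * expR (eta * n%:R) ->
  `|f (- n%:R) y| <= C * expR (eta * n%:R) ->
  forall t, `|t| <= n%:R ->
  (1 - q) * `|f t x - f t y| <=
    expR (eta1 * `|t|) * (k 0 * `|Pc (x - y)| + 2 * C * tail n).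
Proof.
move=> C0 x1 x2 y1 y2 t tn.
have D1 : `|f n%:R x - f n%:R y| <= 2 * C * expR (eta * n%:R).
  by rewrite (le_trans (ler_normB _ _))//; lra.
have D2 : `|f (- n%:R) x - f (- n%:R) y| <= 2 * C * expR (eta * n%:R).
  by rewrite (le_trans (ler_normB _ _))//; lra.
have c0 : 0 <= 2 * C * expR (eta * n%:R) by rewrite !mulr_ge0 ?expR_ge0.
have kn t' := ltW (orbit_k0 O t').
have <- : expR (- eta1 * n%:R) * (k (- n%:R) * (2 * C * expR (eta * n%:R)) +
    k n%:R * (2 * C * expR (eta * n%:R))) = 2 * C * tail n.
  have -> : tail n = expR (- eta1 * n%:R) * expR (eta * n%:R) * (k (- n%:R) + k
    n%:R).
    by rewrite /tail -expRD -mulrDl opprB addrC.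
  ring.
apply: (orbit_estimate hdot O gap1 q1) => //.
- by rewrite mulr_ge0.
- by rewrite mulr_ge0.
- move=> r; rewrite ler_norml => /andP[r1 _]; rewrite -linearB.
  apply: (le_trans (orbit_s O _ r1)).
  by rewrite opprK -mulrA mulrCA ler_wpM2l ?expR_ge0// ler_wpM2l.
- move=> r; rewrite ler_norml => /andP[_ r2]; rewrite -linearB.
  apply: (le_trans (orbit_u O _ r2)).
  by rewrite -mulrA mulrCA ler_wpM2l ?expR_ge0// ler_wpM2l.
Qed.

Lemma tail_small (C e : R) : 0 <= C -> 0 < e -> exists N : nat,
  forall n, (N <= n)%N -> C * tail n <= e.
Proof.
move=> C0 e0.
have C1 : 0 < C + 1 by rewrite ltr_wpDl.
have [] := @tempered_tail R k (eta1 - eta) (e / (C + 1)) (orbit_k0 O)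
  (orbit_tempered O).
- by rewrite subr_gt0.
- by rewrite divr_gt0.
move=> N hN; exists N => n /hN h.
rewrite (le_trans (ler_wpM2l C0 h))// mulrCA ler_piMr ?(ltW e0)//.
by rewrite ler_pdivrMr// mul1r lerDl.
Qed.

(** As the segment grows the boundary terms vanish, leaving the center part at time 0. Uniqueness
    and the Lipschitz bound both come from here. *)
Lemma slow_orbit_estimate x y : slow_orbit x -> slow_orbit y ->
  forall t, (1 - q) * `|f t x - f t y| <= expR (eta1 * `|t|) * (k 0 * `|Pc (x -
    y)|).
Proof.
move=> [C1 h1] [C2 h2] t; apply/ler_addgt0Pr => e e0.
pose C := `|C1| + `|C2|.
have hb z C' : (forall t, `|f t z| <= C' * expR (eta * `|t|)) -> C' <= C ->
    forall n : nat, `|f n%:R z| <= C * expR (eta * n%:R) /\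
                    `|f (- n%:R) z| <= C * expR (eta * n%:R).
  move=> hz C'C n; have a1 := hz n%:R; have a2 := hz (- n%:R).
  rewrite normrN normr_nat in a2; rewrite normr_nat in a1.
  by split; [apply: (le_trans a1)|apply: (le_trans a2)]; rewrite ler_wpM2r
    ?expR_ge0.
have C0 : 0 <= 2 * C by rewrite mulr_ge0// addr_ge0.
have [N hN] := tail_small C0 (divr_gt0 e0 (expR_gt0 (eta1 * `|t|))).
pose n := maxn N (Num.truncn `|t|).+1.
have [x1 x2] := hb x C1 h1 (ler_wpDr (normr_ge0 C2) (ler_norm C1)) n.
have [y1 y2] := hb y C2 h2 (ler_wpDl (normr_ge0 C1) (ler_norm C2)) n.
have tn : `|t| <= n%:R.
  by rewrite (le_trans (ltW (truncnS_gt _)))// ler_nat leq_maxr.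
have C0' : 0 <= C by rewrite addr_ge0.
apply: (le_trans (slow_segment_estimate C0' x1 x2 y1 y2 tn)).
rewrite mulrDr lerD2l mulrC -ler_pdivlMr ?expR_gt0//.
by apply: hN; rewrite leq_maxl.
Qed.

Lemma slow_orbit0 : slow_orbit 0.
Proof. by exists 0 => t; rewrite (orbit_fixed O) normr0 mul0r. Qed.

Lemma slow_orbit_bound x t : slow_orbit x ->
  `|f t x| <= (1 - q)^-1 * k 0 * `|Pc x| * expR (eta1 * `|t|).
Proof.
move=> /slow_orbit_estimate/(_ slow_orbit0 t).
rewrite (orbit_fixed O) !subr0 => h.
by rewrite -!mulrA ler_pdivlMl ?subr_gt0// (le_trans h)// mulrC mulrA.
Qed.

Lemma slow_orbit_inj x y : slow_orbit x -> slow_orbit y -> Pc x = Pc y -> x = y.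
Proof.
move=> hx hy xy; apply/eqP; rewrite -subr_eq0 -normr_le0.
have := slow_orbit_estimate hx hy 0.
rewrite !(orbit_0 O) linearB xy subrr !normr0 !mulr0.
by rewrite pmulr_rle0// subr_gt0.
Qed.

Lemma slow_orbit_exists v : Pc v = v -> exists x,
  Pc x = v /\ forall t, `|f t x| <= (1 - q)^-1 * k 0 * `|v| * expR (eta * `|t|).
Proof.
move=> Pv.
have hx (n : nat) : exists x, Pc x = v /\ forall t, `|t| <= n%:R ->
    `|f t x| <= (1 - q)^-1 * k 0 * `|v| * expR (eta * `|t|).
  (* The shooting data is [v] itself, which has no stable or unstable part. Both boundary terms are
     therefore 0, and the bound does not depend on [n]. *)
  have [x xE] := shooting_surjective hdot O gap q1 v (ler0n R n).
  have xc : Pc x = v by rewrite -[RHS]Pv -xE (Pc_shooting O).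
  exists x; split=> // t tn.
  have V0 s : V s (f s 0) = 0 by rewrite (orbit_fixed O) linear0.
  have h : (1 - q) * `|f t x - f t 0| <= expR (eta * `|t|) *
      (k 0 * `|Pc (x - 0)| + expR (- eta * n%:R) * (0 + 0)).
    apply: (orbit_estimate hdot O gap q1) tn => //.
    - move=> r _; rewrite V0 subr0 -(Ps_shooting O) xE -Pv (orbit_sc O) linear0.
      by rewrite normr0 mulr0.
    - move=> r _; rewrite V0 subr0 -(Pu_shooting O) xE -Pv (orbit_uc O) linear0.
      by rewrite normr0 mulr0.
  rewrite (orbit_fixed O) !subr0 addr0 mulr0 addr0 xc in h.
  by rewrite -!mulrA ler_pdivlMl ?subr_gt0// mulrA [leRHS]mulrC.
have [u uP] := choice hx.
pose C := (1 - q)^-1 * k 0 * `|v|.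
have kn := ltW (orbit_k0 O 0).
have C0 : 0 <= C by rewrite !mulr_ge0// invr_ge0 subr_ge0 ltW.
have cu : cvgn u.
  suff : cauchy (u @ \oo) by exact: cauchy_cvg.
  apply: cauchy_exP => e e0.
  have e0' : 0 < (1 - q) * e / 2 by rewrite divr_gt0// mulr_gt0// subr_gt0.
  have [N hN] := tail_small (mulr_ge0 (ler0n _ 2) C0) e0'.
  exists (u N), N => // m Nm /=; rewrite -ball_normE /ball_ /=.
  have [uN1 uN2] := uP N; have [um1 um2] := uP m.
  have Nm' : N%:R <= m%:R :> R by rewrite ler_nat.
  have a1 := uN2 N%:R; have a2 := uN2 (- N%:R).
  have a3 := um2 N%:R; have a4 := um2 (- N%:R).
  rewrite ?normrN !normr_nat in a1 a2 a3 a4.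
  have n0 : `|0 : R| <= N%:R by rewrite normr0.
  (* [u N] and [u m] have the same center part [v], and [u m] obeys the bound at the times -N and N
     since N <= m; only the tail is left. *)
  have := slow_segment_estimate C0 (a1 (lexx _)) (a2 (lexx _)) (a3 Nm') (a4
    Nm') n0.
  rewrite !(orbit_0 O) linearB uN1 um1 subrr !normr0 !mulr0 expR0 mul1r add0r.
  move=> /le_trans/(_ (hN N (leqnn _))) h.
  rewrite -(ltr_pM2l (_ : 0 < 1 - q)) ?subr_gt0//.
  by rewrite (le_lt_trans h)// ltr_pdivrMr// ltr_pMr ?mulr_gt0 ?subr_gt0//
    ltr1n.
pose x := limn u.
have cPc : continuous Pc by exact: linear_le_continuous kn (orbit_Pc O).
exists x; split.
- have : Pc \o u @ \oo --> Pc x by apply: continuous_cvg => //; exact: cPc.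
  rewrite (_ : Pc \o u = fun=> v); last by apply/funext => n /=; have [] := uP
    n.
  by move=> /cvg_lim <- //; rewrite lim_cst.
- move=> t; have cf : (fun n => `|f t (u n)|) @ \oo --> `|f t x|.
    have : f t \o u @ \oo --> f t x.
      by apply: continuous_cvg => //; exact: (orbit_cx O).
    exact: cvg_norm.
  apply: (cvgr_to_le cf); near=> n.
  have [_] := uP n; apply.
  rewrite (le_trans (ltW (truncnS_gt _)))// ler_nat.
  by near: n; exists (Num.truncn `|t|).+1.
Unshelve. all: by end_near. Qed.

(** The derivative is used with the fixed error |x|, not a small one. At the times -N and N it
    transfers the growth bound from [f] to [U], so U(-N) x and U(N) x are of order e^(eta1 N) |Pc
    x|. Going back to time 0, the stable part gains e^(-alpha N) and the unstable part e^(-beta N).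
    Smallness thus comes from [N], which is fixed before the radius. *)
Lemma slow_orbit_tangent e : 0 < e -> exists2 r, 0 < r &
  forall x, slow_orbit x -> `|Pc x| < r -> `|x - Pc x| <= e * `|Pc x|.
Proof.
move=> e0; have [g0 ge ea eb] := gap_rates gap1.
pose c := (1 - q)^-1 * k 0.
have c0 : 0 <= c by rewrite mulr_ge0 ?invr_ge0 ?subr_ge0 ?(ltW q1) ?(ltW
  (orbit_k0 O _)).
have c1 : 0 < 2 * c + 1 by rewrite ltr_wpDl// mulr_ge0.
pose rho := Num.min (alpha - eta1) (beta - eta1).
have rho0 : 0 < rho by rewrite lt_min !subr_gt0 ea.
have [N hN] := tempered_tail (orbit_k0 O) (orbit_tempered O) rho0 (divr_gt0 e0
  c1).
have {}hN := hN N (leqnn _).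
have /nbhs_norm0P[r1 r10 h1] := orbit_tangent O N%:R ltr01.
have /nbhs_norm0P[r2 r20 h2] := orbit_tangent O (- N%:R) ltr01.
have c1' : 0 < c + 1 by rewrite ltr_wpDl.
exists (Num.min r1 r2 / (c + 1)); first by rewrite divr_gt0// lt_min r10.
move=> x hx; rewrite ltr_pdivlMr// lt_min => /andP[x1 x2].
have xc : `|x| <= c * `|Pc x|.
  by have := slow_orbit_bound 0 hx; rewrite (orbit_0 O) normr0 mulr0 expR0
    mulr1.
have xr : `|x| <= `|Pc x| * (c + 1).
  by rewrite (le_trans xc)// mulrC ler_wpM2l// lerDl.
have {}h1 := h1 x (le_lt_trans xr x1); have {}h2 := h2 x (le_lt_trans xr x2).
have E1 : 1 <= expR (eta1 * N%:R).
  rewrite -[X in X <= _]expR0 ler_expR mulr_ge0//; lra.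
have bd (t : R) : `|t| = N%:R -> `|f t x - U t x| <= 1 * `|x| ->
    `|U t x| <= 2 * c * expR (eta1 * N%:R) * `|Pc x|.
  move=> tN hU; have := slow_orbit_bound t hx; rewrite tN -/c => hf.
  have : `|U t x| <= `|f t x| + `|f t x - U t x|.
    by rewrite -[X in `|X| <= _](subKr (f t x)) ler_normB.
  move=> /le_trans; apply.
  have h3 : c * `|Pc x| * 1 <= c * `|Pc x| * expR (eta1 * N%:R).
    by rewrite ler_wpM2l// mulr_ge0.
  lra.
have b1 := bd N%:R (normr_nat _ _) h1.
have b2 : `|U (- N%:R) x| <= 2 * c * expR (eta1 * N%:R) * `|Pc x|.
  by apply: bd => //; rewrite normrN normr_nat.
have sE : `|Ps x| <= k (- N%:R) * expR (- alpha * N%:R) * `|U (- N%:R) x|.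
  have := orbit_s O (t := 0) (s := - N%:R) (U (- N%:R) x).
  by rewrite (orbit_VU O) (orbit_U0 O) sub0r opprK; apply; rewrite oppr_le0.
have uE : `|Pu x| <= k N%:R * expR (- beta * N%:R) * `|U N%:R x|.
  have := orbit_u O (t := 0) (s := N%:R) (U N%:R x).
  by rewrite (orbit_VU O) (orbit_U0 O) sub0r mulrN -mulNr; apply.
have -> : x - Pc x = Ps x + Pu x.
  by rewrite -{1}(orbit_split O x) (addrAC (Ps x)) addrK.
rewrite (le_trans (ler_normD _ _))//.
have kk t := ltW (orbit_k0 O t).
have rs a : rho <= a - eta1 ->
    expR (- a * N%:R) * expR (eta1 * N%:R) <= expR (- rho * N%:R).
  by move=> ha; rewrite -expRD ler_expR -mulrDl ler_wpM2r//; lra.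
have cP : 0 <= 2 * c * `|Pc x| by apply: mulr_ge0 => //; apply: mulr_ge0.
have s1 : `|Ps x| <= k (- N%:R) * expR (- rho * N%:R) * (2 * c * `|Pc x|).
  apply: (le_trans sE).
  rewrite (le_trans (ler_wpM2l _ b2)) ?mulr_ge0 ?expR_ge0//.
  rewrite [leLHS](_ : _ = k (- N%:R) * (expR (- alpha * N%:R) * expR (eta1 *
    N%:R)) *
    (2 * c * `|Pc x|)); last by ring.
  apply: ler_wpM2r; first exact: cP.
  by apply: ler_wpM2l => //; apply: rs; rewrite ge_min lexx.
have u1 : `|Pu x| <= k N%:R * expR (- rho * N%:R) * (2 * c * `|Pc x|).
  apply: (le_trans uE).
  rewrite (le_trans (ler_wpM2l _ b1)) ?mulr_ge0 ?expR_ge0//.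
  rewrite [leLHS](_ : _ = k N%:R * (expR (- beta * N%:R) * expR (eta1 * N%:R)) *
    (2 * c * `|Pc x|)); last by ring.
  apply: ler_wpM2r; first exact: cP.
  by apply: ler_wpM2l => //; apply: rs; rewrite ge_min lexx orbT.
apply: (le_trans (lerD s1 u1)).
rewrite -mulrDl -mulrDl mulrA (mulrC _ (expR _)).
rewrite ler_wpM2r//.
apply: (le_trans (ler_wpM2r _ hN)); first by rewrite mulr_ge0.
by rewrite mulrAC ler_pdivrMr// ler_wpM2l ?(ltW e0)// lerDl.
Qed.

End orbit_center.

(** * The gap condition *)

(** At [eta], [kappa] times the sum of the inverse gaps is exactly 1, so the only slack is
    [kappa * mu]. Taking half the smallest gain for [mu] and giving away half the slack in [q] makes
    every inequality strict at [eta], and continuity carries them to a slightly larger [eta1]. *)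
Lemma gap_condition_near (R : realType) (alpha beta gamma eta : R) :
  0 < gamma -> gamma < eta -> eta < alpha -> eta < beta ->
  let kappa := ((eta - gamma)^-1 + (beta - eta)^-1 + (alpha - eta)^-1)^-1 in
  exists eta1 q, [/\ eta < eta1, q < 1,
    gap_condition alpha beta gamma eta kappa q &
    gap_condition alpha beta gamma eta1 kappa q].
Proof.
move=> g0 ge ea eb kappa.
pose a1 x := (x - gamma)^-1.
pose a2 x := (alpha - x)^-1 - (alpha + x)^-1.
pose a3 x := (beta - x)^-1 - (beta + x)^-1.
pose sg x := (x - gamma)^-1 + (beta - x)^-1 + (alpha - x)^-1.
have sg0 : 0 < sg eta by rewrite !addr_gt0// invr_gt0; lra.
have kappa0 : 0 < kappa by rewrite invr_gt0.
have a10 : 0 < a1 eta by rewrite invr_gt0; lra.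
have a20 : 0 < a2 eta by rewrite subr_gt0 ltf_pV2 ?posrE; lra.
have a30 : 0 < a3 eta by rewrite subr_gt0 ltf_pV2 ?posrE; lra.
pose mu := Num.min (a1 eta) (Num.min (a2 eta) (a3 eta)) / 2.
have mu0 : 0 < mu by rewrite divr_gt0// !lt_min a10 a20.
have muE : mu * 2 = Num.min (a1 eta) (Num.min (a2 eta) (a3 eta)).
  by rewrite mulfVK.
have mu2 : mu < mu * 2 by lra.
have [m1 m2 m3] : [/\ mu < a1 eta, mu < a2 eta & mu < a3 eta].
  by split; rewrite (lt_le_trans mu2)// muE !ge_min lexx ?orbT.
pose q := 1 - kappa * mu / 2.
have km : 0 < kappa * mu by rewrite mulr_gt0.
have kq : kappa * (sg eta - mu) < q.
  by rewrite mulrBr mulVf ?gt_eqF// /q; lra.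
have c1 : a1 x @[x --> eta] --> a1 eta.
  by apply: cvgV; [lra|apply: cvgB; [exact: cvg_id|exact: cvg_cst]].
have cB y : eta < y -> (y - x)^-1 @[x --> eta] --> (y - eta)^-1.
  by move=> h; apply: cvgV; [lra|apply: cvgB; [exact: cvg_cst|exact: cvg_id]].
have cD y : eta < y -> (y + x)^-1 @[x --> eta] --> (y + eta)^-1.
  by move=> h; apply: cvgV; [lra|apply: cvgD; [exact: cvg_cst|exact: cvg_id]].
have c2 : a2 x @[x --> eta] --> a2 eta by apply: cvgB; [exact: cB|exact: cD].
have c3 : a3 x @[x --> eta] --> a3 eta by apply: cvgB; [exact: cB|exact: cD].
have c4 : kappa * (sg x - mu) @[x --> eta] --> kappa * (sg eta - mu).
  apply: cvgMr; apply: cvgB; last exact: cvg_cst.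
  by apply: cvgD; [apply: cvgD; [exact: c1|exact: cB]|exact: cB].
have : \forall x \near eta, [/\ mu < a1 x, mu < a2 x, mu < a3 x &
    kappa * (sg x - mu) < q] /\ (x < alpha /\ x < beta).
  near=> x; split; [split|split]; near: x.
  - exact: (cvgr_gt _ c1).
  - exact: (cvgr_gt _ c2).
  - exact: (cvgr_gt _ c3).
  - exact: (cvgr_lt _ c4).
  - exact: lt_nbhsl.
  - exact: lt_nbhsl.
move=> /nbhs_normP[e /= e0 he].
have [|[h1 h2 h3 h4] [h5 h6]] := he (eta + e / 2).
  by rewrite /ball_ /= opprD addNKr normrN gtr0_norm; lra.
exists (eta + e / 2), q; split.
- lra.
- by rewrite /q; lra.
- split=> //; first exact: ltW.
  by exists mu; split; rewrite ltW.
- split=> //; first by split=> //; lra.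
    exact: ltW.
  by exists mu; split; rewrite ltW.
Unshelve. all: by end_near. Qed.

(** * Linear cocycles *)

Definition pack_linear (R : realType) (V W : normedModType R) (f : V -> W)
    (lf : linear f) : {linear V -> W} :=
  HB.pack f (GRing.isLinear.Build _ _ _ _ f lf).

Lemma linear_continuous_le (R : realType) (V W : normedModType R)
    (f : {linear V -> W}) :
  continuous f -> exists2 C : R, 0 <= C & forall x, `|f x| <= C * `|x|.
Proof.
move=> /linear_bounded_continuous/linear_boundedP/pinfty_ex_gt0[C C0 hC].
by exists C => //; exact: ltW.
Qed.

Lemma uniform_boundedness (R : realType) (V : completeNormedModType R)
    (W : normedModType R) (F : set (V -> W)) :
  (forall f, F f -> linear f /\ exists2 C : R, 0 <= C & forall x, `|f x| <= C *
    `|x|) ->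
  (forall x, exists M : R, forall f, F f -> `|f x| <= M) ->
  exists2 C : R, 0 <= C & forall f, F f -> forall x, `|f x| <= C * `|x|.
Proof.
move=> hF pb; have ub : uniform_bounded F.
  apply: Banach_Steinhauss => // f /hF[lf [C C0 hC]]; split=> // r.
  by exists (C * r) => x xr; rewrite (le_trans (hC x))// ler_wpM2l.
have [M hM] := ub 1.
exists (Num.max 0 M); first by rewrite le_max lexx.
move=> f Ff x; have [lf _] := hF f Ff.
have [->|x0] := eqVneq x 0.
  by rewrite [f 0](linear0 (pack_linear lf)) !normr0 mulr0.
have nx : 0 < `|x| by rewrite normr_gt0.
have := hM f Ff (`|x|^-1 *: x).
rewrite [f _](linearZ_LR (pack_linear lf)) !normrZ normfV normr_id mulVf
  ?gt_eqF//.
move=> /(_ (lexx _)); rewrite ler_pdivrMl// => /le_trans; apply.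
by rewrite mulrC ler_wpM2r// le_max lexx orbT.
Qed.

Lemma continuous_segment_bounded (R : realType) (V : normedModType R)
    (g : R -> V) (N : R) :
  continuous g -> exists M, forall t, `|t| <= N -> `|g t| <= M.
Proof.
move=> cg; have [N0|N0] := leP 0 N; last first.
  by exists 0 => t tN; have := le_lt_trans (le_trans (normr_ge0 t) tN) N0;
    rewrite ltxx.
have [||c _ hc] := @EVT_max _ (fun t => `|g t|) (- N) N.
- by rewrite ge0_cp.
- by apply: continuous_subspaceT => t; apply: cvg_norm; exact: cg.
by exists `|g c| => t tN; apply: hc; rewrite in_itv/= -ler_norml.
Qed.

Section linear_cocycle.
Context {R : realType} {H : completeNormedModType R} {Omega : Type}.
Variables (theta : R -> Omega -> Omega) (U : R -> H -> Omega -> H).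
Hypothesis th0 : forall w, theta 0 w = w.
Hypothesis thD : forall s t w, theta (s + t) w = theta s (theta t w).
Hypothesis U0 : forall x w, U 0 x w = x.
Hypothesis UD : forall t1 t2 x w, U (t1 + t2) x w = U t2 (U t1 x w) (theta t1
  w).
Hypothesis Ulin : forall t w, linear (fun x => U t x w).
Hypothesis Uc : forall t w, continuous (fun x => U t x w).
Hypothesis Ud : forall x w, derivable (fun t : R => U t x w) 0 1.

Let A w x := derive1 (fun t : R => U t x w) 0.
Let V t x w := U (- t) x (theta t w).

Let UB t w x y : U t (x - y) w = U t x w - U t y w.
Proof. exact: (linearB (pack_linear (Ulin t w))). Qed.

Let UZ t w a x : U t (a *: x) w = a *: U t x w.
Proof. exact: (linearZ_LR (pack_linear (Ulin t w))). Qed.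

Lemma cocycle_VK t x w : V t (U t x w) w = x.
Proof. by rewrite /V -UD subrr U0. Qed.

Lemma cocycle_UK t x w : U t (V t x w) w = x.
Proof.
have := UD (- t) t x (theta t w); rewrite -thD addNr th0 U0 => /esym.
exact.
Qed.

Lemma cocycle_VD s t x w : V (s + t) x w = V s (V t x (theta s w)) w.
Proof.
rewrite /V (_ : - (s + t) = - t + - s); last by rewrite opprD addrC.
by rewrite UD -!thD (addrC t s) addrCA addNr addr0.
Qed.

Lemma cocycle_derive0 x w : is_derive (0 : R) 1 (fun t => U t x w) (A w x).
Proof. by split; [exact: Ud|rewrite /A derive1E]. Qed.

Lemma cocycle_derive x w (t : R) :
  is_derive t 1 (fun t => U t x w) (A (theta t w) (U t x w)).
Proof.
apply/is_derive1P => e e0.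
have /is_derive1P/(_ e e0)[r r0 hr] := cocycle_derive0 (U t x w) (theta t w).
by exists r => // h /hr; rewrite add0r UD U0.
Qed.

Lemma cocycle_continuous x w : continuous (fun t => U t x w).
Proof.
move=> t; apply: differentiable_continuous.
by apply/derivable1_diffP; have [] := cocycle_derive x w t.
Qed.

Let U_le t w : exists2 C : R, 0 <= C & forall x, `|U t x w| <= C * `|x|.
Proof. by apply: (@linear_continuous_le _ _ _ (pack_linear (Ulin t w))); exact:
  Uc. Qed.

Lemma cocycle_bounded w (N : R) : exists2 C : R, 0 <= C &
  forall t x, `|t| <= N -> `|U t x w| <= C * `|x|.
Proof.
have [||C C0 hC] := @uniform_boundedness R H H
    [set (fun x => U t x w) | t in [set t : R | `|t| <= N]].
- by move=> _ [t _ <-]; split; [exact: Ulin|exact: U_le].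
- move=> x; have [M hM] := continuous_segment_bounded N (@cocycle_continuous x
  w).
  by exists M => _ [t tN <-]; exact: hM.
by exists C => // t x tN; apply: (hC (fun x => U t x w)); exists t.
Qed.

(** The difference quotients are bounded at each point, by differentiability for small [h] and by
    continuity of orbits for the other [h] in [-1, 1]. Uniform boundedness turns this into an
    operator norm bound. *)
Lemma cocycle_near_id w : exists2 C : R, 0 < C &
  forall h x, `|h| <= 1 -> `|U h x w - x| <= C * `|h| * `|x|.
Proof.
have lin h : linear (fun x => h^-1 *: (U h x w - x)).
  move=> a x y; rewrite [U h _ w](Ulin h w) scalerA mulrC -scalerA -scalerDr.
  congr (_ *: _).
  by rewrite scalerBr opprD addrACA.
have [||C C0 hC] := @uniform_boundedness R H H
    [set (fun x => h^-1 *: (U h x w - x)) | h in [set h : R | 0 < `|h| <= 1]].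
- move=> _ [h _ <-]; split; first exact: lin.
  have [C C0 hC] := U_le h w.
  exists (`|h^-1| * (C + 1)); first by rewrite mulr_ge0// addr_ge0.
  move=> x; rewrite normrZ -mulrA ler_wpM2l// mulrDl mul1r.
  by rewrite (le_trans (ler_normB _ _))// lerD2r.
- move=> x; have /is_derive1P/(_ 1 ltr01)[r r0 hr] := cocycle_derive0 x w.
  have [M hM] := continuous_segment_bounded 1 (@cocycle_continuous x w).
  have M0 : 0 <= M by rewrite (le_trans _ (hM 0 _))// normr0.
  exists (`|A w x| + 1 + r^-1 * (M + `|x|)) => _ [h /= /andP[h0 h1] <-].
  rewrite normrZ normfV ler_pdivrMl//.
  have [hr'|hr'] := ltP `|h| r.
    have := hr h hr'; rewrite add0r U0 mul1r => h2.
    have : `|U h x w - x| <= `|U h x w - x - h *: A w x| + `|h *: A w x|.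
      by rewrite -{1}(subrK (h *: A w x) (U h x w - x)) ler_normD.
    rewrite normrZ => /le_trans; apply.
    have : 0 <= `|h| * (r^-1 * (M + `|x|)).
      by rewrite !mulr_ge0// ?invr_ge0 ?(ltW r0)// addr_ge0.
    lra.
  rewrite (le_trans (ler_normB _ _))// (@le_trans _ _ (M + `|x|))//.
    by rewrite lerD2r hM.
  have : 1 * (M + `|x|) <= `|h| * r^-1 * (M + `|x|).
    by rewrite ler_wpM2r ?addr_ge0// ler_pdivlMr// mul1r.
  have : 0 <= `|h| * (`|A w x| + 1) by rewrite mulr_ge0// addr_ge0.
  lra.
exists (C + 1); first by rewrite ltr_wpDl.
move=> h x h1; have [->|h0] := eqVneq h 0.
  by rewrite U0 subrr !normr0 mulr0 mul0r.
have h0' : 0 < `|h| by rewrite normr_gt0.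
have := hC (fun x => h^-1 *: (U h x w - x)) _ x.
rewrite normrZ normfV ler_pdivrMl// => /(_ _)/le_trans; apply.
  by exists h => //=; rewrite h0'.
by rewrite mulrA ler_wpM2r// mulrC ler_wpM2r// lerDl.
Qed.

(** The bound for [U h] is applied to the vector [V h x w]: its norm is at most |x| plus half of
    itself, hence at most 2 |x|. *)
Lemma cocycle_inv_near_id w : exists2 C : R, 0 < C & exists2 r, 0 < r &
  forall h x, `|h| < r -> `|V h x w - x| <= C * `|h| * `|x| /\ `|V h x w| <= 2
    * `|x|.
Proof.
have [C C0 hC] := cocycle_near_id w.
exists (2 * C); first by rewrite mulr_gt0.
exists (Num.min 1 (2 * C)^-1); first by rewrite lt_min ltr01 invr_gt0 mulr_gt0.
move=> h x; rewrite lt_min => /andP[/ltW h1 h2].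
have := hC h (V h x w) h1; rewrite cocycle_UK distrC => h3.
have Ch : C * `|h| <= 2^-1.
  by move: h2; rewrite invfM -ltr_pdivrMr ?invr_gt0// invrK mulrC => /ltW.
have h4 : C * `|h| * `|V h x w| <= 2^-1 * `|V h x w| by rewrite ler_wpM2r.
have h5 : `|V h x w| <= `|V h x w - x| + `|x| by rewrite -{1}(subrK x (V h x
  w)) ler_normD.
have h6 : `|V h x w| <= 2 * `|x| by lra.
split=> //; rewrite (le_trans h3)// (le_trans (ler_wpM2l _ h6))//.
  by rewrite mulr_ge0// ltW.
lra.
Qed.

(** In [V] the base point moves along with the time, so continuity of orbits says nothing directly.
    Instead V(s) factors through V(s - t) over [theta t w], which is close to the identity. *)
Lemma cocycle_inv_continuous x w : continuous (fun t => V t x w).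
Proof.
move=> t; apply/cvgrPdist_le => e e0.
have [C C0 [r r0 hV]] := cocycle_inv_near_id (theta t w).
have [M M0 hM] := U_le (- t) (theta t w).
have K0 : 0 < M * (C * `|x|) + 1 by rewrite ltr_wpDl// !mulr_ge0// ltW.
have m0 : 0 < Num.min r (e / (M * (C * `|x|) + 1)) by rewrite lt_min r0
  divr_gt0.
apply: filterS (nbhsx_ballx t _ m0) => s.
rewrite -ball_normE /ball_ /= distrC lt_min => /andP[/(hV _ x)[h1 _] h2].
have -> : V s x w = V t (V (s - t) x (theta t w)) w by rewrite -cocycle_VD
  subrKC.
rewrite distrC /V -UB (le_trans (hM _))// (le_trans (ler_wpM2l M0 h1))//.
move: h2; rewrite ltr_pdivlMr// => /ltW h3.
rewrite (@le_trans _ _ (`|s - t| * (M * (C * `|x|) + 1)))//.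
  rewrite mulrDr mulr1 ler_wpDr//; lra.
Qed.

Lemma cocycle_inv_bounded w (N : R) : exists2 C : R, 0 <= C &
  forall t x, `|t| <= N -> `|V t x w| <= C * `|x|.
Proof.
have [||C C0 hC] := @uniform_boundedness R H H
    [set (fun x => V t x w) | t in [set t : R | `|t| <= N]].
- by move=> _ [t _ <-]; split; [exact: Ulin|exact: U_le].
- move=> x; have [M hM] := continuous_segment_bounded N
  (@cocycle_inv_continuous x w).
  by exists M => _ [t tN <-]; exact: hM.
by exists C => // t x tN; apply: (hC (fun x => V t x w)); exists t.
Qed.

Lemma cocycle_inv_derive w (z : R -> H) (t : R) (l : H) :
  is_derive t 1 z (A (theta t w) (z t) + l) ->
  is_derive t 1 (fun s => V s (z s) w) (V t l w).
Proof.
move=> /is_derive1P dz; apply/is_derive1P => e e0.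
have [C C0 [r r0 hV]] := cocycle_inv_near_id (theta t w).
have [M M0 hM] := U_le (- t) (theta t w).
(* Two first-order errors of this relative size, doubled by [V h] and multiplied by the bound [M] of
   [V t], make up at most half of [e]. *)
have e1 : 0 < e / (4 * (M + 1)) / 2 by rewrite !divr_gt0// mulr_gt0// ltr_wpDl.
have [r1 r10 h1] := dz _ e1.
have /is_derive1P/(_ _ e1)[r2 r20 h2] := cocycle_derive0 (z t) (theta t w).
have K0 : 0 < M * (C * `|l|) + 1 by rewrite ltr_wpDl// !mulr_ge0// ltW.
pose r3 := e / 2 / (M * (C * `|l|) + 1).
exists (Num.min (Num.min r r3) (Num.min r1 r2)).
  by rewrite !lt_min r0 r10 r20 !divr_gt0.
move=> h; rewrite !lt_min => /andP[/andP[hr hr3] /andP[hr1 hr2]].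
have [_ v2] := hV h (z (t + h) - U h (z t) (theta t w) - h *: l) hr.
have [v1 _] := hV h l hr.
have -> : V (t + h) (z (t + h)) w - V t (z t) w - h *: V t l w =
    V t (V h (z (t + h) - U h (z t) (theta t w) - h *: l) (theta t w)
         + h *: (V h l (theta t w) - l)) w.
  rewrite cocycle_VD -UZ -!UB; congr (V t _ w).
  rewrite /V UB UB -/(V h (U h _ _) _) cocycle_VK UZ scalerBr.
  by rewrite addrA subrK.
have k1 : `|z (t + h) - U h (z t) (theta t w) - h *: l| <=
    e / (4 * (M + 1)) * `|h|.
  have := h1 h hr1; have := h2 h hr2; rewrite add0r U0 => a2 a1.
  have -> : z (t + h) - U h (z t) (theta t w) - h *: l =
     (z (t + h) - z t - h *: (A (theta t w) (z t) + l)) -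
     (U h (z t) (theta t w) - z t - h *: A (theta t w) (z t)).
    rewrite scalerDr; move: (U h _ _) (h *: A _ _) (h *: l) => p1 p2 p3.
    have cancel (a c y : H) : (a - y) - (c - y) = a - c.
      by rewrite opprD addrACA subrr addr0.
    by rewrite [- (p2 + p3)]opprD [_ - _ + (_ + _)]addrA [RHS]addrAC !cancel.
  rewrite (le_trans (ler_normB _ _))//; lra.
rewrite /V (le_trans (hM _))// (le_trans (ler_wpM2l M0 (ler_normD _ _)))//.
rewrite normrZ.
have k2 : M * `|V h (z (t + h) - U h (z t) (theta t w) - h *: l) (theta t w)| <=
   e / 2 * `|h|.
  rewrite (le_trans (ler_wpM2l M0 v2))//.
  rewrite (le_trans (ler_wpM2l M0 (ler_wpM2l _ k1)))//.
  have -> : M * (2 * (e / (4 * (M + 1)) * `|h|)) = e / 2 * `|h| * (M / (M + 1)).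
    by field; rewrite gt_eqF// ltr_wpDl.
  rewrite ler_piMr ?mulr_ge0 ?divr_ge0 ?(ltW e0)//.
  by rewrite ler_pdivrMr ?ltr_wpDl// mul1r lerDl.
have k3 : M * (`|h| * `|V h l (theta t w) - l|) <= e / 2 * `|h|.
  rewrite (le_trans (ler_wpM2l M0 (ler_wpM2l (normr_ge0 h) v1)))//.
  have -> : M * (`|h| * (C * `|h| * `|l|)) = `|h| * (M * (C * `|l|)) * `|h| by
    ring.
  rewrite ler_wpM2r//.
  move: hr3; rewrite ltr_pdivlMr// => /ltW; apply: le_trans.
  by rewrite ler_wpM2l// lerDl.
rewrite mulrDr; move: k2 k3; rewrite /V; lra.
Qed.

End linear_cocycle.

(** * Trichotomies *)

Section splitting.
Context {R : realType} {H : completeNormedModType R}.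
Variables E F G : set H.
Hypotheses (hE : closed_subspace E) (hF : closed_subspace F)
  (hG : closed_subspace G) (hsum : direct_sum3 E F G).

Lemma direct_sum3_inj a b c a' b' c' :
  E a -> F b -> G c -> E a' -> F b' -> G c' ->
  a + b + c = a' + b' + c' -> [/\ a = a', b = b' & c = c'].
Proof.
move=> Ea Fb Gc Ea' Fb' Gc' eq3.
have [p [_ pu]] := hsum (a + b + c).
have h1 := pu (a, b, c) (And4 Ea Fb Gc erefl).
have h2 := pu (a', b', c') (And4 Ea' Fb' Gc' eq3).
by move: h2; rewrite h1 => -[].
Qed.

Lemma proj_along1 a b c : E a -> F b -> G c ->
  proj_along E (set_sum F G) (a + b + c) = a.
Proof.
move=> Ea Fb Gc; rewrite /proj_along.
set S := [set y | _]; have : S (xget 0 S).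
  apply: xgetPex; exists a; split=> //; rewrite addrAC (addrAC a) subrr add0r.
  by exists b => //; exists c.
move=> [Ey [b' Fb' [c' Gc' eq3]]].
have [] // := @direct_sum3_inj _ _ _ a b c Ey Fb' Gc' Ea Fb Gc.
by rewrite -addrA eq3 subrKC.
Qed.

Lemma proj_along2 a b c : E a -> F b -> G c ->
  proj_along F (set_sum E G) (a + b + c) = b.
Proof.
move=> Ea Fb Gc; rewrite /proj_along.
set S := [set y | _]; have : S (xget 0 S).
  apply: xgetPex; exists b; split=> //; rewrite addrAC addrK.
  by exists a => //; exists c.
move=> [Fy [a' Ea' [c' Gc' eq3]]].
have [] // := @direct_sum3_inj _ _ _ a b c Ea' Fy Gc' Ea Fb Gc.
by rewrite addrAC eq3 subrK.
Qed.

Lemma proj_along3 a b c : E a -> F b -> G c ->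
  proj_along G (set_sum E F) (a + b + c) = c.
Proof.
move=> Ea Fb Gc; rewrite /proj_along.
set S := [set y | _]; have : S (xget 0 S).
  apply: xgetPex; exists c; split=> //; rewrite addrK.
  by exists a => //; exists b.
move=> [Gy [a' Ea' [b' Fb' eq3]]].
have [] // := @direct_sum3_inj _ _ _ a b c Ea' Fb' Gy Ea Fb Gc.
by rewrite eq3 subrK.
Qed.

Lemma direct_sum3_split x : exists a b c,
  [/\ E a, F b, G c & x = a + b + c].
Proof.
by have [[[a b] c] [[/= Ea Fb Gc xE] _]] := hsum x; exists a, b, c.
Qed.

Let P1 := proj_along E (set_sum F G).
Let P2 := proj_along F (set_sum E G).
Let P3 := proj_along G (set_sum E F).

Lemma proj_alongE x : [/\ E (P1 x), F (P2 x), G (P3 x) & P1 x + P2 x + P3 x =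
  x].
Proof.
have [a [b [c [Ea Fb Gc ->]]]] := direct_sum3_split x.
by rewrite /P1 /P2 /P3 proj_along1// proj_along2// proj_along3.
Qed.

Lemma proj_along_combination (r : R) x y :
  [/\ P1 (r *: x + y) = r *: P1 x + P1 y, P2 (r *: x + y) = r *: P2 x + P2 y
    & P3 (r *: x + y) = r *: P3 x + P3 y].
Proof.
have [Ex Fx Gx xE] := proj_alongE x; have [Ey Fy Gy yE] := proj_alongE y.
have eq3 : r *: x + y = (r *: P1 x + P1 y) + (r *: P2 x + P2 y) +
    (r *: P3 x + P3 y).
  by rewrite -{1}xE -{1}yE !scalerDr addrACA (addrACA (r *: P1 x)).
have e1 := subspaceP hE r Ex Ey; have f1 := subspaceP hF r Fx Fy.
have g1 := subspaceP hG r Gx Gy.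
by rewrite {1 2 3}eq3 /P1 /P2 /P3 proj_along1// proj_along2// proj_along3.
Qed.

Lemma proj_along1_linear : linear P1.
Proof. by move=> r x y; have [] := proj_along_combination r x y. Qed.

Lemma proj_along2_linear : linear P2.
Proof. by move=> r x y; have [] := proj_along_combination r x y. Qed.

Lemma proj_along3_linear : linear P3.
Proof. by move=> r x y; have [] := proj_along_combination r x y. Qed.

Lemma proj_along_first a : E a -> [/\ P1 a = a, P2 a = 0 & P3 a = 0].
Proof.
move=> Ea; have F0 := subspace0 hF; have G0 := subspace0 hG.
have -> : a = a + 0 + 0 by rewrite !addr0.
by rewrite /P1 /P2 /P3 proj_along1// proj_along2// proj_along3// !addr0.
Qed.

Lemma proj_along_second b : F b -> [/\ P1 b = 0, P2 b = b & P3 b = 0].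
Proof.
move=> Fb; have E0 := subspace0 hE; have G0 := subspace0 hG.
have -> : b = 0 + b + 0 by rewrite add0r addr0.
by rewrite /P1 /P2 /P3 proj_along1// proj_along2// proj_along3// add0r addr0.
Qed.

Lemma proj_along_third c : G c -> [/\ P1 c = 0, P2 c = 0 & P3 c = c].
Proof.
move=> Gc; have E0 := subspace0 hE; have F0 := subspace0 hF.
have -> : c = 0 + 0 + c by rewrite !add0r.
by rewrite /P1 /P2 /P3 proj_along1// proj_along2// proj_along3// !add0r.
Qed.

End splitting.

Lemma op_norm_le (R : realType) (H : completeNormedModType R)
    (T : {linear H -> H}) (C : R) (x : H) :
  (op_norm T <= C%:E)%E -> `|T x| <= C * `|x|.
Proof.
move=> hT; have [->|x0] := eqVneq x 0; first by rewrite linear0 !normr0 mulr0.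
have nx : 0 < `|x| by rewrite normr_gt0.
have : (`|T (`|x|^-1 *: x)|%:E <= C%:E)%E.
  apply: le_trans hT; apply: ereal_sup_ubound; exists (`|x|^-1 *: x) => //=.
  by rewrite normrZ normfV normr_id mulVf ?gt_eqF.
by rewrite lee_fin linearZ normrZ normfV normr_id ler_pdivrMl// mulrC.
Qed.

Lemma limf_esup_lt (R : realType) (f : R -> R) (F : set_system R) (d : R) :
  Filter F -> limf_esup (fun t => (f t)%:E) F = 0%:E -> 0 < d ->
  \forall t \near F, f t <= d.
Proof.
move=> FF + d0; rewrite limf_esupE => f0.
have : (ereal_inf [set ereal_sup [set (f t)%:E | t in V] | V in F] < d%:E)%E.
  by rewrite f0 lte_fin.
move=> /ereal_inf_lt[_ [V FV <-] supV].
apply: filterS FV => t Vt; rewrite -lee_fin (le_trans _ (ltW supV))//.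
by apply: ereal_sup_ubound; exists t.
Qed.

Section tempered_growth.
Context {R : realType} {d : measure_display} {Omega : measurableType d}.
Variables (theta : R -> Omega -> Omega) (W : set Omega).
Hypothesis theta_W : theta_invariant theta W.

Lemma theta_invariantP t w : W w -> W (theta t w).
Proof. by move=> Ww; have := theta_W t; move=> /seteqP[_ /(_ w Ww)]. Qed.

Lemma tempered_expR_le (X : Omega -> R) w e : tempered theta W X -> W w ->
  0 < e -> exists T, forall t, T <= `|t| -> X (theta t w) <= expR (e * `|t|).
Proof.
move=> [_ X0 hX _] Ww e0; have [hp hn] := hX w Ww.
have := limf_esup_lt _ hp e0 => /(_ _)[T1 [_ h1]].
have := limf_esup_lt _ hn e0 => /(_ _)[T2 [_ h2]].
(* At least 1 keeps |t| away from 0; the unit margins produce the strict inequalities that define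
   the neighbourhoods of both infinities. *)
exists (Num.max 1 (Num.max (T1 + 1) (1 - T2))) => t.
rewrite !ge_max => /andP[t1 /andP[t2 t3]].
have t0 : 0 < `|t| by rewrite (lt_le_trans _ t1).
have Xt : 0 < X (theta t w) by apply: X0; exact: theta_invariantP.
have : log_plus (X (theta t w)) / `|t| <= e.
  have [tt|tt] := leP 0 t.
    by apply: h1; move: t2; rewrite ger0_norm//; lra.
  by apply: h2; move: t3; rewrite ltr0_norm//; lra.
rewrite ler_pdivrMr// /log_plus ge_max => /andP[_].
by move=> hl; rewrite -[X _]lnK ?posrE// ler_expR.
Qed.

End tempered_growth.

(** * Orbits of the random dynamical system *)

Section random_orbit.
Context {R : realType} {H : completeNormedModType R}.
Context {d : measure_display} {Omega : measurableType d}.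
Variables (P : probability Omega R) (theta : R -> Omega -> Omega).
Hypothesis htheta : ergodic_flow P theta.
Variable phi : R -> H -> Omega -> H.
Hypotheses (hphi : rds theta phi) (hsmooth : smooth_at_fixed_point phi).
Let U := linearization phi.
Hypothesis hU : linear_rds theta U.
Variables (W : set Omega) (Es Ec Eu : Omega -> set H).
Variables (alpha beta gamma : R) (Ks Kc Ku : Omega -> R).
Hypothesis htri :
  exponential_trichotomy Es Ec Eu P theta U W alpha beta gamma Ks Kc Ku.

Definition trichotomy_constant (w : Omega) := Num.max (Ks w) (Num.max (Kc w)
  (Ku w)).
Let K := trichotomy_constant.

Let Ps := Ps Es Ec Eu.
Let Pc := Pc Es Ec Eu.
Let Pu := Pu Es Ec Eu.

Lemma trichotomy_split w : W w ->
  [/\ closed_subspace (Es w), closed_subspace (Ec w), closed_subspace (Eu w)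
    & direct_sum3 (Es w) (Ec w) (Eu w)].
Proof. by move=> Ww; have [] := tri_closed htri Ww; have := tri_sum htri Ww.
  Qed.

Lemma W_theta t w : W w -> W (theta t w).
Proof. exact: (theta_invariantP (tri_invariant htri)). Qed.

Lemma Ps_linear w : W w -> linear (Ps w).
Proof. by move=> /trichotomy_split[? ? ? ?]; exact: proj_along1_linear. Qed.

Lemma Pc_linear w : W w -> linear (Pc w).
Proof. by move=> /trichotomy_split[? ? ? ?]; exact: proj_along2_linear. Qed.

Lemma Pu_linear w : W w -> linear (Pu w).
Proof. by move=> /trichotomy_split[? ? ? ?]; exact: proj_along3_linear. Qed.

(** Each fibre is mapped into the corresponding fibre, so the image of the splitting of [x] is a
    splitting of the image, and splittings over [theta t w] are unique. *)
Lemma projections_commute w t x : W w ->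
  [/\ Ps (theta t w) (U t x w) = U t (Ps w x) w,
      Pc (theta t w) (U t x w) = U t (Pc w x) w &
      Pu (theta t w) (U t x w) = U t (Pu w x) w].
Proof.
move=> Ww; have [hs hc hu hsum] := trichotomy_split Ww.
have [Sx Cx Ux xE] := proj_alongE hsum x.
have [ts tc tu] := tri_stable htri t Ww.
have [_ _ _ hsum'] := trichotomy_split (W_theta t Ww).
have UD y z : U t (y + z) w = U t y w + U t z w.
  exact: (linearD (pack_linear (hU.2 t w))).
have S' : Es (theta t w) (U t (Ps w x) w) by apply: ts; exists (Ps w x).
have C' : Ec (theta t w) (U t (Pc w x) w) by apply: tc; exists (Pc w x).
have U' : Eu (theta t w) (U t (Pu w x) w) by apply: tu; exists (Pu w x).
have -> : U t x w = U t (Ps w x) w + U t (Pc w x) w + U t (Pu w x) w.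
  by rewrite -!UD [_ + _ + _]xE.
split.
- by apply: (proj_along1 hsum').
- by apply: (proj_along2 hsum').
- by apply: (proj_along3 hsum').
Qed.

Let th0 := flow0 htheta.
Let thD := flowD htheta.
Let U0 := rds0 hU.1.
Let UD := rdsD hU.1.
Let Ulin := hU.2.

Let Uc t w : continuous (fun x => U t x w).
Proof. exact: diff_continuous (space_diff hsmooth t 0 w). Qed.

Let Ud := time_derivable_lin hsmooth.

Definition U_at w t : {linear H -> H} := pack_linear (Ulin t w).
Definition V_at w t : {linear H -> H} := pack_linear (Ulin (- t) (theta t w)).

Lemma K_le w : [/\ Ks w <= K w, Kc w <= K w & Ku w <= K w].
Proof. by rewrite /K /trichotomy_constant !le_max !lexx !orbT. Qed.

Lemma K_gt0 w : W w -> 0 < K w.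
Proof.
move=> Ww; have [[_ hs _ _] _ _] := tri_tempered htri.
by have [+ _ _] := K_le w; apply: lt_le_trans; exact: hs.
Qed.

Lemma K_tempered w e : W w -> 0 < e -> exists T, forall t, T <= `|t| ->
  K (theta t w) <= expR (e * `|t|).
Proof.
move=> Ww e0; have [ts tc tu] := tri_tempered htri.
have inv := tri_invariant htri.
have [T1 h1] := tempered_expR_le inv ts Ww e0.
have [T2 h2] := tempered_expR_le inv tc Ww e0.
have [T3 h3] := tempered_expR_le inv tu Ww e0.
exists (Num.max T1 (Num.max T2 T3)) => t; rewrite !ge_max.
by move=> /and3P[/h1 k1 /h2 k2 /h3 k3]; rewrite k1 k2 k3.
Qed.

(** The transported projection is the projected cocycle started over [theta s w]; hence the constant
    of the bounds below is evaluated at [theta s w]. *)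
Let UPV (Q : Omega -> H -> H) w t s x :
  (forall t x, Q (theta t w) (U t x w) = U t (Q w x) w) ->
  U t (Q w (V_at w s x)) w = U (t - s) (Q (theta s w) x) (theta s w).
Proof.
move=> hQ; have -> : x = U s (V_at w s x) w by rewrite (cocycle_UK th0 thD U0
  UD).
rewrite hQ [V_at w s (U _ _ _)](cocycle_VK U0 UD).
by rewrite -UD subrKC.
Qed.

Lemma trichotomy_s w t s x : W w -> s <= t ->
  `|U t (Ps w (V_at w s x)) w| <= K (theta s w) * expR (- alpha * (t - s)) *
    `|x|.
Proof.
move=> Ww st; rewrite UPV; last by move=> r y; have [] := projections_commute r
  y Ww.
have Ws := W_theta s Ww.
have := @op_norm_le _ _ (U_at (theta s w) (t - s) \o pack_linear (Ps_linear
  Ws))%FUN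
  _ x (tri_s htri Ws (_ : 0 <= t - s)).
rewrite subr_ge0 => /(_ st)/le_trans; apply.
by rewrite ler_wpM2r// ler_wpM2r ?expR_ge0//; have [] := K_le (theta s w).
Qed.

Lemma trichotomy_c w t s x : W w ->
  `|U t (Pc w (V_at w s x)) w| <= K (theta s w) * expR (gamma * `|t - s|) *
    `|x|.
Proof.
move=> Ww; rewrite UPV; last by move=> r y; have [] := projections_commute r y
  Ww.
have Ws := W_theta s Ww.
have := @op_norm_le _ _ (U_at (theta s w) (t - s) \o pack_linear (Pc_linear
  Ws))%FUN
  _ x (tri_c htri (t - s) Ws).
move=> /le_trans; apply.
by rewrite ler_wpM2r// ler_wpM2r ?expR_ge0//; have [] := K_le (theta s w).
Qed.

Lemma trichotomy_u w t s x : W w -> t <= s ->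
  `|U t (Pu w (V_at w s x)) w| <= K (theta s w) * expR (beta * (t - s)) * `|x|.
Proof.
move=> Ww st; rewrite UPV; last by move=> r y; have [] := projections_commute r
  y Ww.
have Ws := W_theta s Ww.
have := @op_norm_le _ _ (U_at (theta s w) (t - s) \o pack_linear (Pu_linear
  Ws))%FUN
  _ x (tri_u htri Ws (_ : t - s <= 0)).
rewrite subr_le0 => /(_ st)/le_trans; apply.
by rewrite ler_wpM2r// ler_wpM2r ?expR_ge0//; have [] := K_le (theta s w).
Qed.

Variables (LipB eta : R).
Let A := linear_part phi.
Let B := nonlinear_part phi.
Hypothesis hgen : generated_by theta A B phi.
Hypothesis hBLip : forall t w u1 u2, W w ->
    `|B (theta t w) u1 - B (theta t w) u2| <= LipB * `|u1 - u2|.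
Hypothesis heta : gamma < eta < Num.min beta alpha.
Let Sigma := (eta - gamma)^-1 + (beta - eta)^-1 + (alpha - eta)^-1.
Hypothesis hgap : forall w, W w -> K w * LipB * Sigma < 1.

Lemma random_orbit w (Ww : W w) :
  trichotomous_orbit (U_at w) (V_at w) (fun t x => phi t x w)
    (fun t x => B (theta t w) x)
    (pack_linear (Ps_linear Ww)) (pack_linear (Pc_linear Ww))
    (pack_linear (Pu_linear Ww)) (fun t => K (theta t w))
    alpha beta gamma Sigma^-1 `|LipB|.
Proof.
have [g0 ga gb] := tri_const htri.
move: heta; rewrite lt_min => /andP[ge /andP[eb ea]].
have Sigma0 : 0 < Sigma by rewrite !addr_gt0// invr_gt0 subr_gt0.
have [hs hc hu hsum] := trichotomy_split Ww.
have cphi x : continuous (fun t => phi t x w).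
  move=> t; apply: differentiable_continuous.
  by apply/derivable1_diffP; have [_ /(_ t)[]] := hgen x w.
have first_in x := let: And4 h _ _ _ := proj_alongE hsum x in
  proj_along_first hc hu hsum h.
have second_in x := let: And4 _ h _ _ := proj_alongE hsum x in
  proj_along_second hs hu hsum h.
have third_in x := let: And4 _ _ h _ := proj_alongE hsum x in
  proj_along_third hs hc hsum h.
split.
- by move=> t x; exact: (cocycle_VK U0 UD).
- by move=> t x; exact: (cocycle_UK th0 thD U0 UD).
- by move=> x; exact: U0.
- move=> N; have [C1 C10 h1] := cocycle_bounded U0 UD Ulin Uc Ud w N.
  have [C2 C20 h2] := cocycle_inv_bounded th0 thD U0 UD Ulin Uc Ud w N.
  exists (C1 + C2); first exact: addr_ge0.
  move=> t x tN; split.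
    by rewrite (le_trans (h1 t x tN))// ler_wpM2r// lerDl.
  by rewrite (le_trans (h2 t x tN))// ler_wpM2r// lerDr.
- by move=> x; exact: (rds0 hphi).
- by move=> t; exact: (fixed_point0 hsmooth).
- exact: cphi.
- by move=> t x; apply: differentiable_continuous; exact: (space_diff hsmooth).
- move=> x t; apply: (cocycle_inv_derive th0 thD U0 UD Ulin Uc Ud).
  by have [_ /(_ t)] := hgen x w.
- move=> t e e0; have /diff_locally/eqaddoP/(_ e e0) := space_diff hsmooth t 0
  w.
  apply: filterS => x /=.
  rewrite -[X in `|X| <= _ -> _]/(phi t (x + 0) w - (phi t 0 w + U t x w)).
  by rewrite addr0 (fixed_point0 hsmooth) add0r.
(* [LipB] comes with no sign, whereas the orbit needs a nonnegative constant. *)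
- exact: normr_ge0.
- move=> t x y; rewrite (le_trans (hBLip t x y Ww))// ler_wpM2r//.
  exact: ler_norm.
- move=> t x y; have Wt := W_theta t Ww.
  rewrite (le_trans (ler_wpM2l (ltW (K_gt0 Wt)) (hBLip t x y Ww)))// mulrA.
  by rewrite ler_wpM2r// -[leRHS]mul1r ler_pdivlMr// ltW// hgap.
- by move=> x; have [_ _ _ xE] := proj_alongE hsum x; exact: xE.
- by move=> x; have [] := first_in x.
- by move=> x; have [] := second_in x.
- by move=> x; have [] := third_in x.
- by move=> x; have [] := first_in x.
- by move=> x; have [] := second_in x.
- by move=> x; have [] := third_in x.
- by move=> x; have [] := first_in x.
- by move=> x; have [] := second_in x.
- by move=> x; have [] := third_in x.
- by move=> t; exact: K_gt0 (W_theta t Ww).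
- by move=> e e0; exact: K_tempered.
- by move=> t s x st; exact: trichotomy_s.
- by move=> t s x; exact: trichotomy_c.
- by move=> t s x st; exact: trichotomy_u.
Qed.

End random_orbit.

(** * Measurability in separable spaces *)

Lemma measurable_fun_ltP d (T : measurableType d) (R : realType) (D : set T)
    (f : T -> R) :
  (forall r, measurable (D `&` [set x | f x < r])) -> measurable_fun D f.
Proof.
move=> mf mD; apply: (measurability _ (RGenInftyO.measurableE R)) => //.
by move=> _ [_ [x ->] <-]; rewrite preimage_itvNyo.
Qed.

Lemma measurable_fun_lt_set d (T : measurableType d) (R : realType) (D : set T)
    (f g : T -> R) :
  measurable D -> measurable_fun D f -> measurable_fun D g ->
  measurable (D `&` [set x | f x < g x]).
Proof.
move=> mD mf mg; have mtrue : measurable [set true] by [].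
exact: (measurable_fun_ltr mf mg mD mtrue).
Qed.

Lemma small_inv (R : realType) (e : R) : 0 < e -> exists n : nat, n.+1%:R^-1 <
  e.
Proof.
move=> e0; exists (Num.truncn e^-1).
by rewrite invf_plt ?posrE ?ltr0Sn// truncnS_gt.
Qed.

Lemma separable_dense_seq (R : realType) (H : completeNormedModType R) :
  separable H -> exists e : nat -> H, forall x r, 0 < r -> exists i, `|x - e i|
    < r.
Proof.
move=> [D [/countable_injP[f finj] dD]].
(* Indices that enumerate no point of [D] get the default 0; an extra point does not harm
   density. *)
exists (fun n => xget 0 [set x | D x /\ f x = n]) => x r r0.
have [|y [xy Dy]] := dD (ball x r) _ (ball_open x r).
  by exists x; exact: ballxx.
exists (f y); set z := xget _ _.
have [Dz fz] : [set z | D z /\ f z = f y] z by apply: xgetPex; exists y.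
have -> : z = y by apply: finj; rewrite ?inE.
by move: xy; rewrite -ball_normE.
Qed.

Section metric_measurability.
Context {R : realType} {H : completeNormedModType R}.
Context {d : measure_display} {T : measurableType d}.
Variables (D : set T) (mD : measurable D).
Hypothesis hsep : separable H.
Implicit Types f g : T -> H.

(** A scalar form of Borel measurability, equivalent to it when [H] is separable; it handles
    differences and limits without a Borel structure on a product. *)
Definition dist_measurable f := forall x : H, measurable_fun D (fun w => `|f w
  - x|).

Lemma measurable_fun_dist f :
  measurable_fun D (f : T -> borel H) -> dist_measurable f.
Proof.
move=> mf x; apply: measurable_fun_ltP => r.
have [r0|r0] := leP r 0.
  rewrite (_ : _ `&` _ = set0); first exact: measurable0.
  by rewrite -subset0 => w [_ /= h]; have := lt_le_trans (le_lt_trans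
    (normr_ge0 _) h) r0; rewrite ltxx.
have mb : measurable (ball x r : set (borel H)).
  by apply: sub_sigma_algebra; exact: ball_open.
have := mf mD _ mb; congr (measurable _); apply/seteqP; split=> w [Dw] /=.
  by rewrite -ball_normE /ball_ /= distrC.
by rewrite -ball_normE /ball_ /= distrC.
Qed.

(** An open set is the union of those balls inside it that have a center in the dense sequence and a
    radius 1 / (k + 1). *)
Lemma dist_measurable_borel f :
  dist_measurable f -> measurable_fun D (f : T -> borel H).
Proof.
move=> mf _; have [e he] := separable_dense_seq hsep.
apply: (@measurability _ _ _ (borel H) D f (@open H)) => // _ [Op oO <-].
rewrite (_ : _ `&` _ = \bigcup_i \bigcup_k
  (if pselect (ball (e i) (k.+1%:R^-1) `<=` Op)
   then D `&` [set w | `|f w - e i| < k.+1%:R^-1] else set0)).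
  apply: bigcup_measurable => i _; apply: bigcup_measurable => k _.
  case: pselect => [s|s] /=; last exact: measurable0.
  exact: measurable_fun_lt_set mD (mf (e i)) (measurable_cst _).
apply/seteqP; split=> [w [Dw /= Ofw]|w [i _ [k _]]].
  have := oO; rewrite openE => /(_ _ Ofw)/nbhs_ballP[r /= r0 hr].
  have [k hk] := small_inv (divr_gt0 r0 (ltr0n _ 2)).
  have k0 : 0 < k.+1%:R^-1 :> R by rewrite invr_gt0 ltr0n.
  have [i hi] := he (f w) _ k0.
  exists i => //; exists k => //.
  case: pselect => [s|]; first by split.
  case=> y yi; apply: hr; move: yi; rewrite -!ball_normE /ball_ /= => yi.
  have := ler_distD (e i) (f w) y; move: hi yi hk.
  move: (_^-1) => v; lra.
case: pselect => [s|s] // [Dw /= h]; split=> //=.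
by apply: s; rewrite -ball_normE /ball_ /= distrC.
Qed.

(** |f - g - x| < r holds exactly when |f - (e_i + x)| + |g - e_i| < r for some [i]: density
    supplies e_i near [g], and the triangle inequality gives the converse. *)
Lemma dist_measurableB f g :
  dist_measurable f -> dist_measurable g -> dist_measurable (fun w => f w - g
    w).
Proof.
move=> mf mg x; have [e he] := separable_dense_seq hsep.
apply: measurable_fun_ltP => r.
rewrite (_ : _ `&` _ = \bigcup_i
  (D `&` [set w | `|f w - (e i + x)| + `|g w - e i| < r])).
  apply: bigcup_measurable => i _; apply: measurable_fun_lt_set (measurable_cst
    _) => //.
  exact: measurable_funD.
apply/seteqP; split=> [w [Dw /= h]|w [i _ [Dw /= h]]].
  have h0 : 0 < (r - `|f w - g w - x|) / 2 by rewrite divr_gt0// subr_gt0.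
  have [i hi] := he (g w) _ h0.
  exists i => //; split=> //=.
  have : `|f w - (e i + x)| <= `|f w - g w - x| + `|g w - e i|.
    rewrite [X in `|X| <= _](_ : _ = (f w - g w - x) + (g w - e i))
      ?ler_normD//.
    by rewrite addrAC addrA subrK opprD addrA.
  lra.
split=> //=; apply: le_lt_trans h.
rewrite [X in `|X| <= _](_ : _ = (f w - (e i + x)) - (g w - e i)) ?ler_normB//.
by rewrite !opprD !opprK !addrA addrAC (addrAC _ _ (e i)) subrK addrAC.
Qed.

(* No measurable choice of the approximating indices is made: since all
   admissible approximations converge, it suffices that one exists. *)
Lemma dist_measurable_limit (I : countType) (e : I -> H)
    (S : nat -> I -> T -> Prop) f :
  (forall n i, measurable (D `&` [set w | S n i w])) ->
  (forall w n, D w -> exists i, S n i w) ->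
  (forall w eps, D w -> 0 < eps -> exists N, forall n i, (N <= n)%N ->
    S n i w -> `|f w - e i| <= eps) ->
  dist_measurable f.
Proof.
move=> mS exS cvS x; apply: measurable_fun_ltP => r.
(* [f] is within [r] of [x] exactly when, with some margin 1 / (k + 1) and from some [N] on, each
   level [n] has an admissible point that close. The margin makes the strict inequality survive the
   limit. *)
rewrite (_ : _ `&` _ = \bigcup_k \bigcup_N
   (D `&` \bigcap_(n in [set n | (N <= n)%N]) \bigcup_i
   (if `|e i - x| < r - k.+1%:R^-1 then D `&` [set w | S n i w] else set0))).
  apply: bigcup_measurable => k _; apply: bigcup_measurable => N _.
  apply: measurableI => //.
  apply: bigcap_measurable; first by exists N => /=.
  move=> n _; apply: countable_bigcupT_measurable; first exact: countableP.
  by move=> i; case: ifP.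
apply/seteqP; split=> [w [Dw /= h]|w [k _ [N _ [Dw hN]]]].
  have rf : 0 < (r - `|f w - x|) / 2 by rewrite divr_gt0// subr_gt0.
  have [k hk] := small_inv rf.
  have [N hN] := cvS w _ Dw rf.
  exists k => //; exists N => //; split=> // n /= Nn.
  have [i Si] := exS w n Dw; exists i => //.
  have := hN n i Nn Si; have := ler_distD (f w) (e i) x; rewrite (distrC (e i)
    (f w)).
  move=> h1 h2; rewrite ifT//; move: (k.+1%:R^-1) hk => v hk; lra.
split=> //=.
have k0 : 0 < k.+1%:R^-1 :> R by rewrite invr_gt0 ltr0n.
have [N' hN'] := cvS w _ Dw k0.
have [i _] := hN (maxn N N') (leq_maxl _ _).
case: ifPn => // ei [_ /= Si].
have := hN' (maxn N N') i (leq_maxr _ _) Si; have := ler_distD (e i) (f w) x.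
move: (k.+1%:R^-1) ei => v ei; lra.
Qed.

(** [u] is a Castaing representation of [M], so the distance to [M] is an infimum of countably many
    measurable functions. *)
Lemma measurable_fun_dist_image (M : T -> set H) (u : nat -> T -> H) (x : H) :
  (forall i, dist_measurable (u i)) ->
  (forall w i, D w -> M w (u i w)) ->
  (forall w y eps, D w -> M w y -> 0 < eps -> exists i, `|y - u i w| < eps) ->
  measurable_fun D (fun w => ereal_inf [set `|x - y|%:E | y in M w]).
Proof.
move=> mu uM duM.
apply: (@eq_measurable_fun _ _ _ _ _ (fun w => einfs (fun i => `|u i w - x|%:E)
  0)).
  move=> w; rewrite inE => Dw; apply/eqP; rewrite eq_le; apply/andP; split.
    apply: le_ereal_inf_tmp => _ [y My <-]; apply/lee_addgt0Pr => eps eps0.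
    have [i hi] := duM w y eps Dw My eps0.
    apply: (@le_trans _ _ `|u i w - x|%:E).
      by apply: ereal_inf_lbound; exists i.
    rewrite -EFinD lee_fin; have := ler_distD y (u i w) x.
    rewrite (distrC (u i w) y) (distrC y x); lra.
  apply: le_ereal_inf_tmp => _ [i _ <-]; apply: ereal_inf_lbound.
  by exists (u i w); [exact: uM|rewrite distrC].
apply: (@measurable_fun_einfs _ _ _ _ (fun i w => `|u i w - x|%:E)) => i.
exact/measurable_EFinP/mu.
Qed.

End metric_measurability.

(** * The center projection recovered from growth rates *)

Section center_projection.
Context {R : realType} {H : completeNormedModType R}.
Variables (U V : R -> {linear H -> H}) (f : R -> H -> H) (b : R -> H -> H).
Variables (Ps Pc Pu : {linear H -> H}) (k : R -> R).
Variables alpha beta gamma kappa L : R.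
Hypothesis O : trichotomous_orbit U V f b Ps Pc Pu k alpha beta gamma kappa L.

(** [y] imitates the stable part of [x], [z] the unstable part and c = x - y - z the center part.
    Being tiny at time n (for [y]) or -n (for [z]), they have small center parts; growing slowly,
    [c] has a small stable part, seen from -n, and a small unstable part, seen from n. These four
    terms are the whole error. *)
Lemma orbit_center_approx (eta rho C : R) (n : nat) (x y z : H) :
  rho <= eta - gamma -> rho <= alpha - eta -> rho <= beta - eta ->
  `|U n%:R y| <= C * expR (- eta * n%:R) ->
  `|U (- n%:R) z| <= C * expR (- eta * n%:R) ->
  `|U n%:R (x - y - z)| <= C * expR (eta * n%:R) ->
  `|U (- n%:R) (x - y - z)| <= C * expR (eta * n%:R) ->
  `|Pc x - (x - y - z)| <= 2 * C * (expR (- rho * n%:R) * (k (- n%:R) + k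
    n%:R)).
Proof.
move=> rc rs ru hy hz h1 h2; set c := x - y - z in h1 h2 *.
have xE : x = c + z + y by rewrite /c !subrK.
have kn t := ltW (orbit_k0 O t).
have C0 : 0 <= C.
  by have := le_trans (normr_ge0 _) hy; rewrite pmulr_lge0// expR_gt0.
have bnd (t a e : R) (v u : H) : `|v| <= k t * expR (a * n%:R) * `|u| ->
    `|u| <= C * expR (e * n%:R) -> a + e <= - rho ->
    `|v| <= C * (k t * expR (- rho * n%:R)).
  move=> hv hu ae; apply: (le_trans hv).
  have h0 : 0 <= k t * expR (a * n%:R) by rewrite mulr_ge0 ?expR_ge0.
  apply: (le_trans (ler_wpM2l h0 hu)).
  rewrite [leLHS](_ : _ = C * (k t * (expR (a * n%:R) * expR (e * n%:R))));
    last by ring.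
  by rewrite ler_wpM2l// ler_wpM2l// -expRD -mulrDl ler_expR ler_wpM2r.
have n0 : (0 : R) <= n%:R by [].
have b1 : `|Pc y| <= C * (k n%:R * expR (- rho * n%:R)).
  apply: (bnd _ gamma _ _ _ _ hy); last lra.
  have := orbit_c O 0 n%:R (U n%:R y).
  by rewrite (orbit_VU O) (orbit_U0 O) sub0r normrN normr_nat.
have b2 : `|Pc z| <= C * (k (- n%:R) * expR (- rho * n%:R)).
  apply: (bnd _ gamma _ _ _ _ hz); last lra.
  have := orbit_c O 0 (- n%:R) (U (- n%:R) z).
  by rewrite (orbit_VU O) (orbit_U0 O) sub0r opprK normr_nat.
have b3 : `|Ps c| <= C * (k (- n%:R) * expR (- rho * n%:R)).
  apply: (bnd _ (- alpha) _ _ _ _ h2); last lra.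
  have := orbit_s O (t := 0) (s := - n%:R) (U (- n%:R) c).
  by rewrite (orbit_VU O) (orbit_U0 O) sub0r opprK; apply; rewrite oppr_le0.
have b4 : `|Pu c| <= C * (k n%:R * expR (- rho * n%:R)).
  apply: (bnd _ (- beta) _ _ _ _ h1); last lra.
  have := orbit_u O (t := 0) (s := n%:R) (U n%:R c).
  by rewrite (orbit_VU O) (orbit_U0 O) sub0r mulrN -mulNr; apply.
have -> : Pc x - c = Pc z + Pc y - (Ps c + Pu c).
  rewrite -[X in _ - X](orbit_split O c) (addrC (Ps c)) -(addrA (Pc c)).
  have -> : Pc x = Pc c + (Pc z + Pc y) by rewrite {1}xE !linearD addrA.
  by rewrite opprD addrACA subrr add0r.
have := ler_normB (Pc z + Pc y) (Ps c + Pu c).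
have := ler_normD (Pc z) (Pc y); have := ler_normD (Ps c) (Pu c).
lra.
Qed.

End center_projection.

(** * The center manifold *)

Lemma rds_dist_measurable (R : realType) (H : completeNormedModType R)
    (d : measure_display) (Omega : measurableType d) (theta : R -> Omega ->
      Omega)
    (phi : R -> H -> Omega -> H) (W : set Omega) t x :
  rds theta phi -> measurable W -> dist_measurable W (fun w => phi t x w).
Proof.
move=> hphi mW; apply: measurable_fun_dist => //.
apply: (@measurable_funS _ _ _ _ [set: Omega]) => //.
apply: (measurableT_comp (rds_measurable hphi)
  (g := fun w => ((t, x : borel H), w))).
apply: measurable_fun_pair; last exact: measurable_id.
exact: measurable_cst.
Qed.

Lemma dist_measurable_norm (R : realType) (H : completeNormedModType R)
    (d : measure_display) (T : measurableType d) (D : set T) (f : T -> H) :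
  dist_measurable D f -> measurable_fun D (fun w => `|f w|).
Proof. by move=> /(_ 0); under eq_fun do rewrite subr0. Qed.

Lemma continuous_linear2_near0 (R : realType) (V W : normedModType R)
    (G1 G2 : {linear V -> W}) : continuous G1 -> continuous G2 ->
  forall e : R, 0 < e -> exists2 r, 0 < r &
    forall x, `|x| < r -> `|G1 x| <= e /\ `|G2 x| <= e.
Proof.
move=> /linear_continuous_le[C1 C10 h1] /linear_continuous_le[C2 C20 h2] e e0.
have C0 : 0 < C1 + C2 + 1 by rewrite ltr_wpDl// addr_ge0.
exists (e / (C1 + C2 + 1)); first exact: divr_gt0.
move=> x; rewrite ltr_pdivlMr// => /ltW hx.
have hx1 : 0 <= `|x| * C1 by rewrite mulr_ge0.
have hx2 : 0 <= `|x| * C2 by rewrite mulr_ge0.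
have := normr_ge0 x.
by split; [apply: (le_trans (h1 x))|apply: (le_trans (h2 x))]; lra.
Qed.

Section center_manifold_construction.
Context {R : realType} {H : completeNormedModType R}.
Variable dot : {dot H for (@idfun R)}.
Hypothesis hdot : hilbert_product dot.
Hypothesis hsep : separable H.
Context {d : measure_display} {Omega : measurableType d}.
Variables (P : probability Omega R) (theta : R -> Omega -> Omega).
Hypothesis htheta : ergodic_flow P theta.
Variable phi : R -> H -> Omega -> H.
Hypotheses (hphi : rds theta phi) (hsmooth : smooth_at_fixed_point phi).
Let U := linearization phi.
Hypothesis hU : linear_rds theta U.
Let A := linear_part phi.
Let B := nonlinear_part phi.
Hypothesis hgen : generated_by theta A B phi.
Variables (W : set Omega) (Es Ec Eu : Omega -> set H).
Variables (alpha beta gamma : R) (Ks Kc Ku : Omega -> R).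
Hypothesis htri :
  exponential_trichotomy Es Ec Eu P theta U W alpha beta gamma Ks Kc Ku.
Let K := trichotomy_constant Ks Kc Ku.
Let Pc := Pc Es Ec Eu.
Variables (LipB eta : R).
Hypothesis hBLip : forall t w u1 u2, W w ->
    `|B (theta t w) u1 - B (theta t w) u2| <= LipB * `|u1 - u2|.
Hypothesis heta : gamma < eta < Num.min beta alpha.
Let Sigma := (eta - gamma)^-1 + (beta - eta)^-1 + (alpha - eta)^-1.
Hypothesis hgap : forall w, W w -> K w * LipB * Sigma < 1.

Let orbit w (Ww : W w) :=
  random_orbit htheta hphi hsmooth hU htri hgen hBLip heta hgap Ww.

Let mW : measurable W := tri_measurable htri.

Lemma K_measurable : measurable_fun W K.
Proof.
have [[ms _ _ _] [mc _ _ _] [mu _ _ _]] := tri_tempered htri.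
by apply: measurable_maxr => //; exact: measurable_maxr.
Qed.

(** The trichotomy does not state that the splitting depends measurably on [w]. This is recovered
    from the cocycle, since [S] consists of norm inequalities for [U] at fixed times and fixed
    vectors. *)
Lemma center_projection_measurable x : dist_measurable W (fun w => Pc w x).
Proof.
have [e he] := separable_dense_seq hsep.
have Ueta t y : measurable_fun W (fun w => `|U t y w|).
  by apply: dist_measurable_norm; exact: rds_dist_measurable hU.1 mW.
have [g0 ga gb] := tri_const htri.
move: heta; rewrite lt_min => /andP[ge /andP[eb ea]].
have [ae be] : - alpha <= - eta /\ - beta <= - eta by rewrite !lerN2 !ltW.
have nee : - eta <= eta by rewrite ge0_cp// ltW// (lt_trans g0).
(* The summand 1 leaves room for replacing the stable and unstable parts of [x] by points of the
   dense sequence. *)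
pose C w := K w * `|x| + 1.
have mC (r : R) : measurable_fun W (fun w => C w * r).
  apply: measurable_funM; last exact: measurable_cst.
  apply: measurable_funD; last exact: measurable_cst.
  by apply: measurable_funM; [exact: K_measurable|exact: measurable_cst].
pose y (i : nat * nat) := x - e i.1 - e i.2.
pose S n (i : nat * nat) w :=
  [/\ `|U n%:R (e i.1) w| <= C w * expR (- eta * n%:R),
      `|U (- n%:R) (e i.2) w| <= C w * expR (- eta * n%:R),
      `|U n%:R (y i) w| <= C w * expR (eta * n%:R) &
      `|U (- n%:R) (y i) w| <= C w * expR (eta * n%:R)].
apply: (@dist_measurable_limit _ _ _ _ W mW _ y S).
- move=> n i; rewrite (_ : _ `&` _ =
    (W `&` [set w | `|U n%:R (e i.1) w| <= C w * expR (- eta * n%:R)]) `&`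
    (W `&` [set w | `|U (- n%:R) (e i.2) w| <= C w * expR (- eta * n%:R)]) `&`
    (W `&` [set w | `|U n%:R (y i) w| <= C w * expR (eta * n%:R)]) `&`
    (W `&` [set w | `|U (- n%:R) (y i) w| <= C w * expR (eta * n%:R)])).
    have meas t z r : measurable (W `&` [set w | `|U t z w| <= C w * r]).
      exact: measurable_fun_le mW (Ueta t z) (mC r).
    by apply: measurableI => //; apply: measurableI => //; apply: measurableI.
  apply/seteqP; split=> [w [Ww [s1 s2 s3 s4]]|w [[[[Ww s1] [_ s2]] [_ s3]] [_
    s4]]].
    exact: (conj (conj (conj (conj Ww s1) (conj Ww s2)) (conj Ww s3)) (conj Ww
      s4)).
  exact: (conj Ww (And4 s1 s2 s3 s4)).
- move=> w n Ww; have O := orbit Ww; have [_ _ _ hsum] := trichotomy_split htri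
  Ww.
  set a := Ps Es Ec Eu w x; set b := Pu Es Ec Eu w x.
  have [_ _ _ xE] := proj_alongE hsum x.
  have U_c t : continuous (U_at hU w t).
    exact: diff_continuous (space_diff hsmooth t 0 w).
  (* Halved because two such errors add up in [y (i, j)]. *)
  have small0 : 0 < expR (- eta * n%:R) / 2 by rewrite divr_gt0// expR_gt0.
  have [r r0 hr] := continuous_linear2_near0 (U_c n%:R) (U_c (- n%:R)) small0.
  have [i hi] := he a r r0; have [j hj] := he b r r0.
  have [i1 i2] := hr _ hi; have [j1 j2] := hr _ hj.
  have K0 : 0 <= K w * `|x| by rewrite mulr_ge0// ltW// (K_gt0 htri Ww).
  have nn : (0 : R) <= n%:R by [].
  have es : `|U_at hU w n%:R a| <= K w * `|x| * expR (- eta * n%:R).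
    have := orbit_s O x nn; rewrite (flow0 htheta) (orbit_V0 O) subr0 =>
      /le_trans; apply.
    by rewrite mulrAC ler_wpM2l// ler_expR ler_wpM2r.
  have eu : `|U_at hU w (- n%:R) b| <= K w * `|x| * expR (- eta * n%:R).
    have nn' : - n%:R <= (0 : R) by rewrite oppr_le0.
    have := orbit_u O x nn'; rewrite (flow0 htheta) (orbit_V0 O) subr0 =>
      /le_trans; apply.
    by rewrite mulrAC ler_wpM2l// ler_expR mulrN -mulNr ler_wpM2r.
  have ec t : `|t| = n%:R ->
      `|U_at hU w t (Pc w x)| <= K w * `|x| * expR (eta * n%:R).
    move=> tn; have := orbit_c O t 0 x.
    rewrite (flow0 htheta) (orbit_V0 O) subr0 tn => /le_trans; apply.
    by rewrite mulrAC ler_wpM2l// ler_expR ler_wpM2r// ltW.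
  have E1 : expR (- eta * n%:R) <= expR (eta * n%:R).
    by rewrite ler_expR ler_wpM2r.
  have yE : y (i, j) = Pc w x + (a - e i) + (b - e j).
    have sum3 (p q r1 s1 s2 : H) :
        p + q + r1 - s1 - s2 = q + (p - s1) + (r1 - s2).
      by rewrite (addrA q) addrACA (addrC q) [RHS]addrA.
    by rewrite /y /= -[X in X - _ - _]xE sum3.
  have bnd t : `|t| = n%:R -> `|U_at hU w t (a - e i)| <= expR (- eta * n%:R) /
    2 ->
      `|U_at hU w t (b - e j)| <= expR (- eta * n%:R) / 2 ->
      `|U_at hU w t (y (i, j))| <= C w * expR (eta * n%:R).
    move=> tn h1 h2; rewrite yE /C mulrDl mul1r.
    rewrite [U_at hU w t (_ + _ + _)]linearD [U_at hU w t (Pc w x + _)]linearD.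
    apply: (le_trans (ler_normD _ _)).
    apply: (le_trans (lerD (le_trans (ler_normD _ _) (lerD (ec t tn) h1)) h2)).
    by rewrite -addrA -splitr lerD2l.
  have near (t : R) v z : `|U_at hU w t v| <= K w * `|x| * expR (- eta * n%:R)
    ->
      `|U_at hU w t (v - z)| <= expR (- eta * n%:R) / 2 ->
      `|U_at hU w t z| <= C w * expR (- eta * n%:R).
    move=> h1 h2; rewrite -(subKr v z) linearB /C mulrDl mul1r.
    apply: (le_trans (ler_normB _ _)); apply: (le_trans (lerD h1 h2)).
    by rewrite lerD2l ler_pdivrMr// ler_peMr ?expR_ge0// ler1n.
  exists (i, j); split => /=.
  + exact: near es i1.
  + exact: near eu j2.
  + exact: (bnd _ (normr_nat _ n) i1 j1).
  + have nN : `|- n%:R| = n%:R :> R by rewrite normrN normr_nat.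
    exact: (bnd _ nN i2 j2).
- move=> w eps Ww eps0; have O := orbit Ww.
  pose rho := Num.min (eta - gamma) (Num.min (alpha - eta) (beta - eta)).
  have rho0 : 0 < rho by rewrite !lt_min !subr_gt0 ge ea.
  have C0 : 0 < 2 * C w + 1.
    by rewrite ltr_wpDl// mulr_ge0// addr_ge0// mulr_ge0// ltW// (K_gt0 htri
      Ww).
  have [N hN] := tempered_tail (orbit_k0 O) (orbit_tempered O) rho0 (divr_gt0
    eps0 C0).
  exists N => n i Nn [s1 s2 s3 s4].
  have [r1 r2 r3] : [/\ rho <= eta - gamma, rho <= alpha - eta & rho <= beta -
    eta].
    by rewrite /rho !ge_min !lexx !orbT.
  apply: (le_trans (orbit_center_approx O r1 r2 r3 s1 s2 s3 s4)).
  apply: (le_trans (ler_wpM2l _ (hN n Nn))).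
    by rewrite mulr_ge0// addr_ge0// mulr_ge0// ltW// (K_gt0 htri Ww).
  rewrite mulrCA ler_piMr ?(ltW eps0)//.
  by rewrite ler_pdivrMr// mul1r lerDl.
Qed.

Variables eta1 q : R.
Hypothesis gap : gap_condition alpha beta gamma eta Sigma^-1 q.
Hypothesis gap1 : gap_condition alpha beta gamma eta1 Sigma^-1 q.
Hypothesis eta_lt : eta < eta1.
Hypothesis q1 : q < 1.

Let slow w x := slow_orbit (fun t y => phi t y w) eta x.

Lemma center_setP w x : W w -> center_set phi eta w x <-> slow w x.
Proof.
move=> Ww; have O := orbit Ww; split.
- move=> [_]; set s := ereal_sup _ => soo.
  have hs t : ((expR (- eta * `|t|) * `|phi t x w|)%:E <= s)%E.
    by apply: ereal_sup_ubound; exists t.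
  have sfin : s \is a fin_num.
    rewrite fin_numE; apply/andP; split; last by rewrite lt_eqF.
    by rewrite gt_eqF// (lt_le_trans _ (hs 0))// ltNyr.
  exists (fine s) => t; have := hs t; rewrite -(fineK sfin) lee_fin mulNr expRN.
  by rewrite ler_pdivrMl ?expR_gt0// mulrC.
- move=> [C hC]; split; first exact: (orbit_ct O).
  apply: (@le_lt_trans _ _ C%:E); last exact: ltry.
  apply: ge_ereal_sup => _ [t _ <-]; rewrite lee_fin mulNr expRN.
  by rewrite ler_pdivrMl ?expR_gt0// mulrC.
Qed.

Lemma Pc_id w v : W w -> Ec w v -> Pc w v = v.
Proof.
move=> Ww Ev; have [hs hc hu hsum] := trichotomy_split htri Ww.
by have [] := proj_along_second hs hu hsum Ev.
Qed.

Lemma Pc_in w x : W w -> Ec w (Pc w x).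
Proof.
by move=> Ww; have [_ _ _ hsum] := trichotomy_split htri Ww; have [] :=
  proj_alongE hsum x.
Qed.

(** The selection is made by choice alone; a slow point is determined by its center part, so
    measurability can be proved afterwards. *)
Lemma slow_point_exists : exists u : H -> Omega -> H, forall v w, W w -> Ec w v
  ->
  Pc w (u v w) = v /\
  forall t, `|phi t (u v w) w| <= (1 - q)^-1 * K w * `|v| * expR (eta * `|t|).
Proof.
have hx (p : H * Omega) : exists x, W p.2 -> Ec p.2 p.1 -> Pc p.2 x = p.1 /\
  forall t, `|phi t x p.2| <= (1 - q)^-1 * K p.2 * `|p.1| * expR (eta * `|t|).
  have [Ww|] := pselect (W p.2); last by exists 0.
  have [Ev|] := pselect (Ec p.2 p.1); last by exists 0.
  have [x hx] := slow_orbit_exists hdot (orbit Ww) gap gap1 eta_lt q1 (Pc_id Ww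
    Ev).
  by exists x => _ _; rewrite (flow0 htheta) in hx.
have [u hu] := choice hx.
by exists (fun v w => u (v, w)) => v w; exact: hu (v, w).
Qed.

Variable u : H -> Omega -> H.
Hypothesis uP : forall v w, W w -> Ec w v -> Pc w (u v w) = v /\
  forall t, `|phi t (u v w) w| <= (1 - q)^-1 * K w * `|v| * expR (eta * `|t|).

Lemma slow_point_slow v w : W w -> Ec w v -> slow w (u v w).
Proof. by move=> Ww Ev; have [_ h] := uP Ww Ev; exists ((1 - q)^-1 * K w *
  `|v|). Qed.

Lemma slow_pointE w x : W w -> slow w x -> u (Pc w x) w = x.
Proof.
move=> Ww hx; have Ev := Pc_in x Ww; have [Pu _] := uP Ww Ev.
exact: (slow_orbit_inj hdot (orbit Ww) gap1 eta_lt q1 (slow_point_slow Ww Ev)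
  hx Pu).
Qed.

Lemma slow_lipschitz w x y : W w -> slow w x -> slow w y ->
  `|x - y| <= (1 - q)^-1 * K w * `|Pc w x - Pc w y|.
Proof.
move=> Ww hx hy; have O := orbit Ww.
have := slow_orbit_estimate hdot O gap1 eta_lt q1 hx hy 0.
rewrite !(orbit_0 O) normr0 mulr0 expR0 mul1r (flow0 htheta) linearB => h.
by rewrite -mulrA ler_pdivlMl ?subr_gt0.
Qed.

Let q0 : 0 <= (1 - q)^-1.
Proof. by rewrite invr_ge0 subr_ge0 ltW. Qed.

Let K0 w (Ww : W w) : 0 <= K w.
Proof. by rewrite ltW// (K_gt0 htri Ww). Qed.

Let Pc_le w x : W w -> `|Pc w x| <= K w * `|x|.
Proof. by move=> Ww; have := orbit_Pc (orbit Ww) x; rewrite (flow0 htheta). Qed.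

Let PcB w x y : W w -> Pc w (x - y) = Pc w x - Pc w y.
Proof. by move=> Ww; exact: (linearB (pack_linear (Pc_linear htri Ww))). Qed.

(** A point that passes the growth tests at -n and n and has almost the right center part is close
    to the point of the manifold, by [slow_segment_estimate]. *)
Lemma slow_point_measurable x : dist_measurable W (fun w => u (Pc w x) w).
Proof.
have [e he] := separable_dense_seq hsep.
(* The growth constant of the slow point, with |Pc w x| replaced by its bound K(w) |x|, plus 1 for
   the approximation error. *)
pose C w := (1 - q)^-1 * K w * (K w * `|x|) + 1.
have mK := K_measurable.
have mC (r : R) : measurable_fun W (fun w => C w * r).
  apply: measurable_funM; last exact: measurable_cst.
  apply: measurable_funD; last exact: measurable_cst.
  apply: measurable_funM; apply: measurable_funM => //.
have mphi t y : measurable_fun W (fun w => `|phi t y w|).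
  by apply: dist_measurable_norm; exact: rds_dist_measurable hphi mW.
have mPc y : measurable_fun W (fun w => `|Pc w y - Pc w x|).
  apply: dist_measurable_norm.
  by apply: dist_measurableB => //; exact: center_projection_measurable.
pose S n i w := [/\ `|phi n%:R (e i) w| <= C w * expR (eta * n%:R),
  `|phi (- n%:R) (e i) w| <= C w * expR (eta * n%:R) &
  `|Pc w (e i) - Pc w x| <= n.+1%:R^-1].
have C0 w : W w -> 0 <= C w.
  move=> Ww; have k0 := K0 Ww.
  by apply: addr_ge0 => //; apply: mulr_ge0; apply: mulr_ge0.
apply: (@dist_measurable_limit _ _ _ _ W mW _ e S).
- move=> n i.
  have m1 t : measurable (W `&` [set w | `|phi t (e i) w| <= C w * expR (eta *
    n%:R)]).
    exact: measurable_fun_le mW (mphi t (e i)) (mC _).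
  have m2 : measurable (W `&` [set w | `|Pc w (e i) - Pc w x| <= n.+1%:R^-1]).
    exact: measurable_fun_le mW (mPc (e i)) (measurable_cst _).
  rewrite (_ : _ `&` _ =
    (W `&` [set w | `|phi n%:R (e i) w| <= C w * expR (eta * n%:R)]) `&`
    (W `&` [set w | `|phi (- n%:R) (e i) w| <= C w * expR (eta * n%:R)]) `&`
    (W `&` [set w | `|Pc w (e i) - Pc w x| <= n.+1%:R^-1])).
    by apply: measurableI => //; apply: measurableI.
  apply/seteqP; split=> [w [Ww [s1 s2 s3]]|w [[[Ww s1] [_ s2]] [_ s3]]].
    exact: (conj (conj (conj Ww s1) (conj Ww s2)) (conj Ww s3)).
  exact: (conj Ww (And3 s1 s2 s3)).
- move=> w n Ww; have O := orbit Ww.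
  have Ev := Pc_in x Ww; have [Puv hu] := uP Ww Ev.
  set z := u (Pc w x) w in Puv hu.
  have k0 := K0 Ww.
  have C1 : (1 - q)^-1 * K w * `|Pc w x| <= C w - 1.
    by rewrite /C addrK ler_wpM2l ?mulr_ge0// Pc_le.
  have E1 : 1 <= expR (eta * n%:R).
    rewrite -[X in X <= _]expR0 ler_expR mulr_ge0//.
    by have [_ ge _ _] := gap_rates gap; rewrite ltW// (lt_trans _ ge)//;
      have [] := gap_rates gap.
  have bnd t y : `|t| = n%:R -> `|phi t z w - phi t y w| <= 1 ->
      `|phi t y w| <= C w * expR (eta * n%:R).
    move=> tn hy; rewrite -[X in `|X| <= _](subKr (phi t z w)).
    apply: (le_trans (ler_normB _ _)); have := hu t; rewrite tn => ht.
    apply: (le_trans (lerD ht (le_trans hy E1))).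
    by rewrite -{2}[expR _]mul1r -mulrDl ler_wpM2r ?expR_ge0// -lerBrDr.
  have near t : exists2 r, 0 < r & forall y, `|z - y| < r -> `|phi t z w - phi
    t y w| <= 1.
    have cphi : continuous (fun y => phi t y w) by exact: (orbit_cx O).
    have /cvgrPdist_le/(_ 1 ltr01) := cphi z.
    move=> /nbhs_normP[r r0 hr].
    by exists r => // y zy; apply: hr.
  have [r1 r10 h1] := near n%:R; have [r2 r20 h2] := near (- n%:R).
  have r30 : 0 < n.+1%:R^-1 / (K w + 1).
    by rewrite divr_gt0 ?invr_gt0 ?ltr0Sn// ltr_wpDl.
  have rr : 0 < Num.min (Num.min r1 r2) (n.+1%:R^-1 / (K w + 1)).
    by rewrite !lt_min r10 r20.
  have [i hi] := he z _ rr.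
  move: hi; rewrite !lt_min => /andP[/andP[hi1 hi2] hi3].
  exists i; split.
  + exact: (bnd _ _ (normr_nat _ n) (h1 _ hi1)).
  + have nN : `|- n%:R| = n%:R :> R by rewrite normrN normr_nat.
    exact: (bnd _ _ nN (h2 _ hi2)).
  + rewrite -Puv distrC -PcB//; apply: (le_trans (Pc_le _ Ww)).
    move: hi3; rewrite ltr_pdivlMr ?ltr_wpDl// => /ltW; apply: le_trans.
    by rewrite mulrC ler_wpM2l// lerDl.
- move=> w eps Ww eps0; have O := orbit Ww; have k0 := K0 Ww.
  have Ev := Pc_in x Ww; have [Puv hu] := uP Ww Ev.
  set z := u (Pc w x) w in Puv hu *.
  (* The error budget (1 - q) eps is shared equally between the tail and the discrepancy of the
     center parts. *)
  have e0 : 0 < (1 - q) * eps / 2 by rewrite divr_gt0// mulr_gt0// subr_gt0.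
  have C2 : 0 <= 2 * C w by rewrite mulr_ge0// C0.
  have [N1 hN1] := tail_small O eta_lt C2 e0.
  have e1 : 0 < (1 - q) * eps / 2 / (K w + 1) by rewrite divr_gt0// ltr_wpDl.
  have [N2 hN2] := small_inv e1.
  have C1 : (1 - q)^-1 * K w * `|Pc w x| <= C w.
    rewrite /C; apply: ler_wpDr => //; rewrite ler_wpM2l ?mulr_ge0// Pc_le//.
  exists (maxn N1 N2) => n i; rewrite geq_max => /andP[n1 n2] [s1 s2 s3].
  have hz t : `|t| = n%:R -> `|phi t z w| <= C w * expR (eta * n%:R).
    move=> tn; have := hu t; rewrite tn => /le_trans; apply.
    by rewrite ler_wpM2r ?expR_ge0.
  have nN : `|- n%:R| = n%:R :> R by rewrite normrN normr_nat.
  have t0 : `|0 : R| <= n%:R by rewrite normr0.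
  have := slow_segment_estimate hdot O gap1 q1 (C0 w Ww)
    (hz _ (normr_nat _ n)) (hz _ nN) s1 s2 t0.
  rewrite !(orbit_0 O) normr0 mulr0 expR0 mul1r => est.
  have t1 := hN1 n n1.
  have t2 : K w * `|Pc w (z - e i)| <= (1 - q) * eps / 2.
    rewrite PcB// Puv distrC (le_trans (ler_wpM2l k0 s3))//.
    have h3 : n.+1%:R^-1 <= (1 - q) * eps / 2 / (K w + 1).
      rewrite (le_trans _ (ltW hN2))// lef_pV2 ?posrE ?ltr0Sn// ler_nat.
      by rewrite ltnS.
    rewrite (le_trans (ler_wpM2l k0 h3))// mulrCA ler_piMr ?(ltW e0)//.
    by rewrite ler_pdivrMr ?ltr_wpDl// mul1r lerDl.
  rewrite -(ler_pM2l (_ : 0 < 1 - q)) ?subr_gt0//.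
  apply: (le_trans est); rewrite (flow0 htheta).
  by apply: (le_trans (lerD t2 t1)); rewrite -splitr.
Qed.

Lemma slow_point_center_manifold :
  center_manifold Es Ec Eu theta phi W (center_set phi eta)
    (fun v w => u v w - v).
Proof.
have [e he] := separable_dense_seq hsep.
have zeroE w : W w -> u 0 w = 0.
  move=> Ww; have [_ hc _ _] := trichotomy_split htri Ww.
  have [_ /(_ 0)] := uP Ww (subspace0 hc).
  rewrite normr0 mulr0 mul0r (orbit_0 (orbit Ww)) normr_le0 => /eqP.
  exact.
split.
- move=> x.
  apply: (@measurable_fun_dist_image _ _ _ _ W _ (fun i w => u (Pc w (e i)) w)).
  + by move=> i; exact: slow_point_measurable.
  + by move=> w i Ww; apply/(center_setP _ Ww); apply: slow_point_slow => //;
    exact: Pc_in.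
  (* Points over the projected dense sequence are dense in the manifold, since a slow point depends
     in a Lipschitz way on its center part and the projection is bounded. *)
  + move=> w y eps Ww /(center_setP _ Ww) hy eps0; have k0 := K0 Ww.
    have c0 : 0 <= (1 - q)^-1 * K w * K w by rewrite !mulr_ge0.
    have c1 : 0 < (1 - q)^-1 * K w * K w + 1 by rewrite ltr_wpDl.
    have [i hi] := he y _ (divr_gt0 eps0 c1); exists i.
    have Ev := Pc_in (e i) Ww; have [Pui _] := uP Ww Ev.
    apply: (le_lt_trans (slow_lipschitz Ww hy (slow_point_slow Ww Ev))).
    rewrite Pui -PcB//.
    have h0 : 0 <= (1 - q)^-1 * K w by rewrite mulr_ge0.
    apply: (le_lt_trans (ler_wpM2l h0 (Pc_le (y - e i) Ww))).
    move: hi; rewrite ltr_pdivlMr// mulrDr mulr1 => hi.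
    rewrite mulrA mulrC; apply: le_lt_trans hi.
    by rewrite lerDl.
- move=> t w Ww t0 _ [x /(center_setP _ Ww)[C hC] <-].
  apply/(center_setP _ (W_theta htri t Ww)).
  (* By the cocycle property the shifted orbit is the old one at time t + s, and |t + s| <= |t| +
     |s|. The absolute value is there because [C] has no known sign. *)
  exists (`|C| * expR (eta * `|t|)) => s.
  rewrite -(rdsD hphi) (le_trans (hC (t + s)))//.
  rewrite (@le_trans _ _ (`|C| * expR (eta * `|t + s|)))//.
    by rewrite ler_wpM2r ?expR_ge0// ler_norm.
  rewrite -mulrA ler_wpM2l// -expRD ler_expR -mulrDr ler_wpM2l ?ler_normD//.
  by have [g0 ge _ _] := gap_rates gap; rewrite ltW// (lt_trans g0).
- move=> w Ww; apply/seteqP; split=> [y /(center_setP _ Ww) hy|_ [v Ev <-]].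
    by exists (Pc w y); [exact: Pc_in|rewrite slow_pointE// subrKC].
  by rewrite subrKC; apply/(center_setP _ Ww); exact: slow_point_slow.
- move=> w v Ww Ev; have [_ _ _ hsum] := trichotomy_split htri Ww.
  have [Pui _] := uP Ww Ev.
  have [Sx Cx Ux xE] := proj_alongE hsum (u v w).
  exists (Pu Es Ec Eu w (u v w)) => //; exists (Ps Es Ec Eu w (u v w)) => //.
  rewrite -[X in _ = X - _]xE -[X in _ = _ - X]Pui /Pc /Defs.Pc.
  by rewrite addrAC addrK addrC.
- move=> w Ww; have [_ hc _ _] := trichotomy_split htri Ww.
  apply: (@klipschitzW _ _ _ ((1 - q)^-1 * K w + 1)).
    by apply: (@globally_properfilter _ _ (0, 0)); split; exact: subspace0 hc.
  move=> [v v'] /= [Ev Ev'].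
  have [Pv _] := uP Ww Ev; have [Pv' _] := uP Ww Ev'.
  have := slow_lipschitz Ww (slow_point_slow Ww Ev) (slow_point_slow Ww Ev').
  rewrite Pv Pv' => h.
  have -> : u v w - v - (u v' w - v') = (u v w - u v' w) - (v - v').
    by rewrite (opprD (u v' w)) addrACA -opprD.
  by rewrite (le_trans (ler_normB _ _))// mulrDl mul1r lerD2r.
- by move=> w Ww; rewrite zeroE// subrr.
(* The value of the graph map at [v] is x - Pc x for the slow point x over [v], which is the
   quantity bounded by [slow_orbit_tangent]. *)
- move=> w Ww eps eps0; have O := orbit Ww.
  have [r r0 hr] := slow_orbit_tangent hdot O gap1 eta_lt q1 eps0.
  rewrite near_withinE; apply/nbhs_norm0P; exists r => //= v vr Ev.
  have [Pv _] := uP Ww Ev.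
  rewrite zeroE// !subr0.
  have := hr _ (slow_point_slow Ww Ev).
  by rewrite [pack_linear _ _]Pv; exact.
- move=> x; apply: dist_measurable_borel => //.
  apply: dist_measurableB => //; first exact: slow_point_measurable.
  exact: center_projection_measurable.
Qed.

End center_manifold_construction.

Theorem theorem8 (R : realType)
  (H : completeNormedModType R) (dot : {dot H for (@idfun R)})
  (hdot : hilbert_product dot) (hsep : separable H)
  (d : measure_display) (Omega : measurableType d) (P : probability Omega R)
  (hP : measure_is_complete P)
  (theta : R -> Omega -> Omega) (htheta : ergodic_flow P theta)
  (phi : R -> H -> Omega -> H) (hphi : rds theta phi)
  (hsmooth : smooth_at_fixed_point phi)
  (U : R -> H -> Omega -> H) (U_def : U = linearization phi)
  (hU : linear_rds theta U)
  (A B : Omega -> H -> H)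
  (A_def : A = linear_part phi) (B_def : B = nonlinear_part phi)
  (hgen : generated_by theta A B phi)
  (W : set Omega) (Es Ec Eu : Omega -> set H)
  (alpha beta gamma : R) (Ks Kc Ku : Omega -> R)
  (htri : exponential_trichotomy Es Ec Eu P theta U W alpha beta gamma
    Ks Kc Ku)
  (LipB : R)
  (hB0 : forall t w, W w -> B (theta t w) 0 = 0)
  (hBLip : forall t w u1 u2, W w ->
    `|B (theta t w) u1 - B (theta t w) u2| <= LipB * `|u1 - u2|)
  (eta : R) (heta : gamma < eta < Num.min beta alpha)
  (hgap : forall w, W w ->
    Num.max (Ks w) (Num.max (Kc w) (Ku w)) * LipB
      * ((eta - gamma)^-1 + (beta - eta)^-1 + (alpha - eta)^-1) < 1) :
  exists h : H -> Omega -> H,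
    center_manifold Es Ec Eu theta phi W (center_set phi eta) h.
Proof.
subst U A B; have [g0 _ _] := tri_const htri.
have := heta; rewrite lt_min => /andP[ge /andP[eb ea]].
have [eta1 [q [eta_lt q1 gap gap1]]] := gap_condition_near g0 ge ea eb.
have [u uP] := slow_point_exists hdot htheta hphi hsmooth hU hgen htri hBLip
  heta
  hgap gap gap1 eta_lt q1.
exists (fun v w => u v w - v).
exact: (slow_point_center_manifold hdot hsep htheta hphi hsmooth hU hgen htri
  hBLip
  heta hgap gap gap1 eta_lt q1 uP).
Qed.
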